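(* There exists a set $D\subset(-2,2)^4$, dense in $[-2,2]^4$, such that for every $\mathcal B\in D$ the action of the mapping class group $\Gamma$ of the four-holed sphere $M$ on $\mathcal M_{\mathcal B}$ is minimal, i.e. every $\Gamma$-orbit is dense in $\mathcal M_{\mathcal B}$.
   Context: $M$ is a four-holed sphere with $\pi_1(M)=\langle A,B,C,D : ABCD=I\rangle$, where $A,B,C,D$ correspond to the four boundary components. Put $X=AB$, $Y=BC$, $Z=CA$. For $\mathcal B=(a,b,c,d)\in(-2,2)^4$ and $G=\mathrm{SU}(2)$ or $\mathrm{SL}(2,\mathbb R)$, let $\mathcal H_{\mathcal B}(G)$ be the set of completely reducible representations $\rho:\pi_1(M)\to G$ with $(\operatorname{tr}\rho(A),\operatorname{tr}\rho(B),\operatorname{tr}\rho(C),\operatorname{tr}\rho(D))=\mathcal B$, and $\mathcal M_{\mathcal B}(G)=\mathcal H_{\mathcal B}(G)/G$ (quotient by conjugation). Points of the moduli space are described by the global coordinates $(x,y,z)=(\operatorname{tr}\rho(X),\operatorname{tr}\rho(Y),\operatorname{tr}\rho(Z))\in\mathbb R^3$, which satisfy $$x^2+y^2+z^2+xyz=(ab+cd)x+(ad+bc)y+(ac+bd)z-(a^2+b^2+c^2+d^2+abcd-4).\quad( * )$$ The space $\mathcal M_{\mathcal B}\subset\mathbb R^3$ (with the subspace topology) is either $\mathcal M_{\mathcal B}(\mathrm{SU}(2))$ or the compact component $\mathcal M_{\mathcal B}(\mathrm{SL}(2,\mathbb R))^c$ of $\mathcal M_{\mathcal B}(\mathrm{SL}(2,\mathbb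 R))$, depending on $\mathcal B$. With $I^{\pm}_{a,b}=\frac{ab\pm\sqrt{(a^2-4)(b^2-4)}}{2}$ and $I^{\pm}_{c,d}$ defined likewise: if the intervals $[I^-_{a,b},I^+_{a,b}]$ and $[I^-_{c,d},I^+_{c,d}]$ meet, then $\mathcal M_{\mathcal B}=\mathcal M_{\mathcal B}(\mathrm{SU}(2))$; if they are disjoint, then $\mathcal M_{\mathcal B}=\mathcal M_{\mathcal B}(\mathrm{SL}(2,\mathbb R))^c$, which is the set of real solutions of $( * )$ whose $x$-coordinate lies in the closed interval between the two intervals ($[I^+_{a,b},I^-_{c,d}]$ or $[I^+_{c,d},I^-_{a,b}]$). $\Gamma$ is the mapping class group of $M$ fixing $\partial M$ (isotopy classes of diffeomorphisms of $M$ fixing $\partial M$). It acts by $\gamma(\rho)(W)=\rho(\gamma^{-1}(W))$ and preserves $\mathcal M_{\mathcal B}$. It is generated by the Dehn twists $\tau_X,\tau_Y$ in $X,Y$, which act in coordinates by $$\tau_X:(x,y,z)\mapsto(x,\;ad+bc-xz'-y,\;z'),\quad z'=ac+bd-xy-z,$$ $$\tau_Y:(x,y,z)\mapsto(x',\;y,\;ac+bd-yx'-z),\quad x'=ab+cd-yz-x.$$ *)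

(* Defs.v *)
From mathcomp Require Import all_boot all_order all_algebra.
From mathcomp Require Import complex.
From mathcomp Require Import all_classical all_reals all_analysis.

Set Implicit Arguments.
Unset Strict Implicit.
Unset Printing Implicit Defensive.

Import Order.TTheory GRing.Theory Num.Theory.
Import numFieldNormedType.Exports.

Local Open Scope classical_set_scope.
Local Open Scope ring_scope.

(* O is a dense subset of the subspace M of T *)
Definition dense_in (T : topologicalType) (M O : set T) : Prop :=
  O `<=` M /\ M `<=` closure O.

Section Representations.
Variable F : fieldType.

(* A homomorphism rho from <A, B, C, D : ABCD = I> to a matrix group is the
   same thing as the quadruple of images of the generators. *)
Record quad := Quad { imA : 'M[F]_2; imB : 'M[F]_2; imC : 'M[F]_2; imD : 'M[F]_2 }.

Definition representation (G : set 'M[F]_2) (rho : quad) : Prop :=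
  [/\ G (imA rho), G (imB rho), G (imC rho), G (imD rho) &
      imA rho *m imB rho *m imC rho *m imD rho = 1%:M].

(* A subspace of column vectors is encoded by (the transposes of) the rows
   of V, hence the transpose acting on the right. *)
Definition invariant_space (rho : quad) (V : 'M[F]_2) : bool :=
  [&& stablemx V (imA rho)^T, stablemx V (imB rho)^T,
      stablemx V (imC rho)^T & stablemx V (imD rho)^T].

Definition completely_reducible (rho : quad) : Prop :=
  forall V : 'M[F]_2, invariant_space rho V ->
    exists W : 'M[F]_2,
      [/\ invariant_space rho W, (V + W :=: 1%:M)%MS & (V :&: W)%MS = 0].

End Representations.

Section Moduli.
Variable R : realType.

Definition SL2R : set 'M[R]_2 := [set g | \det g = 1].

Definition SU2 : set 'M[R[i]]_2 :=
  [set g | g \is unitarymx /\ \det g = 1].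

(* R^3 with coordinates (x, y, z), and R^4 with coordinates (a, b, c, d) *)
Local Notation space := (R * R * R)%type.
Local Notation bdata := (R * R * R * R)%type.

(* In the next two definitions j is the inclusion of R in the field over
   which the group G is defined. *)
Definition HB_set (F : fieldType) (j : R -> F) (G : set 'M[F]_2) (B : bdata) :
    set (quad F) :=
  let: (a, b, c, d) := B in
  [set rho | [/\ representation G rho, completely_reducible rho &
    [/\ \tr (imA rho) = j a, \tr (imB rho) = j b,
        \tr (imC rho) = j c & \tr (imD rho) = j d]]].

(* The quotient by conjugation, seen in R^3 through its global coordinates
   (tr rho(AB), tr rho(BC), tr rho(CA)). *)
Definition moduli (F : fieldType) (j : R -> F) (G : set 'M[F]_2) (B : bdata) :
    set space :=
  [set p | let: (x, y, z) := p in
    exists2 rho, HB_set j G B rho &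
      [/\ \tr (imA rho *m imB rho) = j x,
          \tr (imB rho *m imC rho) = j y &
          \tr (imC rho *m imA rho) = j z]].

Definition moduli_SU2 (B : bdata) : set space :=
  moduli (fun t : R => t%:C%C) SU2 B.

Definition moduli_SL2R (B : bdata) : set space :=
  moduli (fun t : R => t) SL2R B.

Definition moduli_SL2R_compact (B : bdata) : set space :=
  [set p | moduli_SL2R B p /\
           compact (connected_component (moduli_SL2R B) p)].

Definition Iminus (a b : R) : R :=
  (a * b - Num.sqrt ((a ^+ 2 - 4) * (b ^+ 2 - 4))) / 2.
Definition Iplus (a b : R) : R :=
  (a * b + Num.sqrt ((a ^+ 2 - 4) * (b ^+ 2 - 4))) / 2.

Definition intervals_meet (B : bdata) : Prop :=
  let: (a, b, c, d) := B in
  `[Iminus a b, Iplus a b] `&` `[Iminus c d, Iplus c d] !=set0.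

Definition MB (B : bdata) : set space :=
  if `[< intervals_meet B >] then moduli_SU2 B else moduli_SL2R_compact B.

(* tauX is induced by (A, B, C, D) |-> (A, B, X C X^-1, X D X^-1), X = A B,
   and tauY by (A, B, C, D) |-> (A, Y^-1 B Y, Y^-1 C Y, D), Y = B C. *)
Definition tauX (B : bdata) (p : space) : space :=
  let: (a, b, c, d) := B in
  let: (x, y, z) := p in
  let z' := a * c + b * d - x * y - z in
  (x, a * d + b * c - x * z' - y, z').

Definition tauY (B : bdata) (p : space) : space :=
  let: (a, b, c, d) := B in
  let: (x, y, z) := p in
  let x' := a * b + c * d - y * z - x in
  (x', y, a * c + b * d - y * x' - z).

(* The transformations of R^3 by which the mapping class group acts: the group
   generated by the Dehn twists in AB and BC. *)
Inductive Gamma (B : bdata) : (space -> space) -> Prop :=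
| Gamma_tauX : Gamma B (tauX B)
| Gamma_tauY : Gamma B (tauY B)
| Gamma_id : Gamma B idfun
| Gamma_comp f g : Gamma B f -> Gamma B g -> Gamma B (f \o g)
| Gamma_inv f g : Gamma B f -> cancel f g -> cancel g f -> Gamma B g.

Definition Gamma_orbit (B : bdata) (p : space) : set space :=
  [set q | exists2 g, Gamma B g & q = g p].

Definition minimal_action (B : bdata) : Prop :=
  forall p, MB B p -> dense_in (MB B) (Gamma_orbit B p).

Definition open_box : set bdata :=
  [set B | let: (a, b, c, d) := B in
    [/\ -2 < a < 2, -2 < b < 2, -2 < c < 2 & -2 < d < 2]].

Definition closed_box : set bdata :=
  [set B | let: (a, b, c, d) := B in
    [/\ -2 <= a <= 2, -2 <= b <= 2, -2 <= c <= 2 & -2 <= d <= 2]].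

End Moduli.

Arguments open_box : clear implicits.
Arguments closed_box : clear implicits.

(* Main.v *)
(* In the coordinates (x, y, z) the moduli space lies on a cubic surface whose
   section at abscissa x is an ellipse when |x| < 2; it is the part of the
   surface between the two middle roots of the quartic
   (x^2 - abx + a^2 + b^2 - 4) (x^2 - cdx + c^2 + d^2 - 4).  For x = 2 cos t the
   twist tauX rotates this ellipse by the angle 2t, and tauY acts likewise on
   the sections at fixed y.  Hence, unless t is a rational multiple of pi, an
   orbit closure C containing one point of an x-section contains all of it.

   If C contains a nondegenerate x-section, it also contains the y-sections
   through its points, at first for irrational y, which sweep out a
   neighbourhood of that x-section; so the set of abscissae whose section lies
   in C is open and closed, and C is everything.

   Otherwise every point of C has, for x as well as for y, either a rational
   angle or a degenerate section.  The points reached by one twist then satisfy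
   polynomial relations in (a, b, c, d) with coefficients in the countable set
   of traces 2 cos (pi m / n).  The set D consists of the data avoiding these
   countably many relations, for which moreover the quartic has simple roots.

   In the SL(2, R) case, a point outside the middle range is connected to
   infinity by an arc on the surface, which lifts to representations. *)

Require Import Defs.
From mathcomp Require Import all_boot all_order all_algebra.
From mathcomp Require Import complex.
From mathcomp Require Import all_classical all_reals all_analysis.
From mathcomp Require Import ring lra.

Set Implicit Arguments.
Unset Strict Implicit.
Unset Printing Implicit Defensive.

Import Order.TTheory GRing.Theory Num.Theory.
Import numFieldNormedType.Exports.

Local Open Scope classical_set_scope.
Local Open Scope ring_scope.

(** * Trace identities for 2 x 2 matrices *)

Section Matrices2.
Variable F : fieldType.
Implicit Types A B C D X V : 'M[F]_2.

Definition mx2 (p q r s : F) : 'M[F]_2 :=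
  \matrix_(i, j) if i == 0 then (if j == 0 then p else q)
                 else (if j == 0 then r else s).

Lemma mx2_ind (P : 'M[F]_2 -> Prop) :
  (forall p q r s, P (mx2 p q r s)) -> forall A, P A.
Proof.
move=> H A.
suff -> : A = mx2 (A 0 0) (A 0 1) (A 1 0) (A 1 1) by exact: H.
by apply/matrixP => -[[|[|//]] Hi] [[|[|//]] Hj]; rewrite !mxE /=;
  congr (A _ _); apply: val_inj.
Qed.

Lemma mulmx2 p q r s p' q' r' s' : mx2 p q r s *m mx2 p' q' r' s' =
  mx2 (p * p' + q * r') (p * q' + q * s') (r * p' + s * r') (r * q' + s * s').
Proof.
by apply/matrixP => -[[|[|//]] Hi] [[|[|//]] Hj];
  rewrite !mxE !big_ord_recl big_ord0 !mxE /= addr0.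
Qed.

Lemma trmx2 p q r s : \tr (mx2 p q r s) = p + s.
Proof. by rewrite /mxtrace !big_ord_recl big_ord0 !mxE /= addr0. Qed.

Lemma detmx2 p q r s : \det (mx2 p q r s) = p * s - q * r.
Proof.
rewrite (expand_det_row _ 0) !big_ord_recl big_ord0 /cofactor !det_mx11 !mxE /=.
by rewrite addr0 expr0 expr1 mul1r mulN1r mulrN.
Qed.

Lemma scalarmx2 c : c%:M = mx2 c 0 0 c.
Proof.
by apply/matrixP => -[[|[|//]] Hi] [[|[|//]] Hj]; rewrite !mxE /= ?mulr1n ?mulr0n.
Qed.

Lemma eq_mx2 p q r s p' q' r' s' : p = p' -> q = q' -> r = r' -> s = s' ->
  mx2 p q r s = mx2 p' q' r' s'.
Proof. by move=> -> -> -> ->. Qed.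

(** The adjugate, which is the inverse when the determinant is 1. In this Cayley-Hamilton form it
    visibly stabilizes every subspace stable under [A]. *)
Definition adj2 A : 'M[F]_2 := (\tr A)%:M - A.

Lemma adj2E p q r s : adj2 (mx2 p q r s) = mx2 s (- q) (- r) p.
Proof.
rewrite /adj2 trmx2 scalarmx2.
apply/matrixP => -[[|[|//]] Hi] [[|[|//]] Hj]; rewrite !mxE /=; ring.
Qed.

Definition mx2rE := (adj2E, mulmx2, trmx2, detmx2, scalarmx2).

Lemma mul_adj2 A : A *m adj2 A = (\det A)%:M.
Proof. elim/mx2_ind: A => p q r s; rewrite !mx2rE; apply: eq_mx2; ring. Qed.

Lemma adj2_mul A : adj2 A *m A = (\det A)%:M.
Proof. elim/mx2_ind: A => p q r s; rewrite !mx2rE; apply: eq_mx2; ring. Qed.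

Lemma adj2M A B : adj2 (A *m B) = adj2 B *m adj2 A.
Proof.
elim/mx2_ind: A => p q r s; elim/mx2_ind: B => p' q' r' s'.
rewrite !mx2rE; apply: eq_mx2; ring.
Qed.

Lemma adj2K : involutive adj2.
Proof. by elim/mx2_ind => p q r s; rewrite !mx2rE; apply: eq_mx2; ring. Qed.

Lemma tr_adj2 A : \tr (adj2 A) = \tr A.
Proof. by elim/mx2_ind: A => p q r s; rewrite !mx2rE; ring. Qed.

Lemma det_adj2 A : \det (adj2 A) = \det A.
Proof. by elim/mx2_ind: A => p q r s; rewrite !mx2rE; ring. Qed.

(* The trace identities are homogenised by the determinants, so that they are
   polynomial identities in the entries. *)
Lemma fricke_relation A B C :
  \tr (A *m B) ^+ 2 * \det C + \tr (B *m C) ^+ 2 * \det A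
    + \tr (C *m A) ^+ 2 * \det B + \tr (A *m B) * \tr (B *m C) * \tr (C *m A)
  = (\tr A * \tr B * \det C + \tr C * \tr (A *m B *m C)) * \tr (A *m B)
    + (\tr A * \tr (A *m B *m C) + \tr B * \tr C * \det A) * \tr (B *m C)
    + (\tr A * \tr C * \det B + \tr B * \tr (A *m B *m C)) * \tr (C *m A)
    - (\tr A ^+ 2 * \det B * \det C + \tr B ^+ 2 * \det A * \det C
       + \tr C ^+ 2 * \det A * \det B + \tr (A *m B *m C) ^+ 2
       + \tr A * \tr B * \tr C * \tr (A *m B *m C)
       - 4 * \det A * \det B * \det C).
Proof.
elim/mx2_ind: A => p q r s; elim/mx2_ind: B => p' q' r' s'.
elim/mx2_ind: C => p2 q2 r2 s2.
rewrite !mx2rE; ring.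
Qed.

(** For determinants 1 the right-hand side is [kappa (\tr A) (\tr B) (\tr (A *m B)) + 2], with
    [kappa] as defined below. *)
Lemma tr_commutator A B :
  \tr (A *m B *m adj2 A *m adj2 B) = \tr A ^+ 2 * \det B + \tr B ^+ 2 * \det A
    + \tr (A *m B) ^+ 2 - \tr A * \tr B * \tr (A *m B) - 2 * \det A * \det B.
Proof.
elim/mx2_ind: A => p q r s; elim/mx2_ind: B => p' q' r' s'.
rewrite !mx2rE; ring.
Qed.

Lemma tr_twistX_z A B C :
  \tr (A *m B *m C *m adj2 B) = \tr A * \tr C * \det B
    + \tr B * \tr (A *m B *m C) - \tr (A *m B) * \tr (B *m C)
    - \det B * \tr (C *m A).
Proof.
elim/mx2_ind: A => p q r s; elim/mx2_ind: B => p' q' r' s'.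
elim/mx2_ind: C => p2 q2 r2 s2.
rewrite !mx2rE; ring.
Qed.

Lemma tr_twistX_y A B C :
  \tr (B *m (A *m B *m C *m adj2 (A *m B))) =
    \tr A * \tr (A *m B *m C) * \det B + \tr B * \tr C * (\det A * \det B)
    - \tr (A *m B) * \tr (A *m B *m C *m adj2 B)
    - \det A * \det B * \tr (B *m C).
Proof.
elim/mx2_ind: A => p q r s; elim/mx2_ind: B => p' q' r' s'.
elim/mx2_ind: C => p2 q2 r2 s2.
rewrite !mx2rE; ring.
Qed.

Lemma tr_twistY_x A B C :
  \tr (A *m (adj2 C *m B *m C)) = \tr A * \tr B * \det C
    + \tr C * \tr (A *m B *m C) - \tr (B *m C) * \tr (C *m A)
    - \det C * \tr (A *m B).
Proof.
elim/mx2_ind: A => p q r s; elim/mx2_ind: B => p' q' r' s'.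
elim/mx2_ind: C => p2 q2 r2 s2.
rewrite !mx2rE; ring.
Qed.

Lemma tr_twistY_z A B C :
  \tr (adj2 (B *m C) *m C *m (B *m C) *m A) =
    \tr A * \tr C * (\det B * \det C) + \tr B * \tr (A *m B *m C) * \det C
    - \tr (B *m C) * \tr (A *m (adj2 C *m B *m C))
    - \det B * \det C * \tr (C *m A).
Proof.
elim/mx2_ind: A => p q r s; elim/mx2_ind: B => p' q' r' s'.
elim/mx2_ind: C => p2 q2 r2 s2.
rewrite !mx2rE; ring.
Qed.

Lemma tr_untwistX_z A B C :
  \tr (adj2 (A *m B) *m C *m (A *m B) *m A) =
    \tr A * \tr C * (\det A * \det B) + \tr B * \tr (A *m B *m C) * \det A
    - \tr (A *m B) * \tr (B *m (adj2 A *m C *m A))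
    - \det A * \det B * \tr (C *m A).
Proof.
elim/mx2_ind: A => p q r s; elim/mx2_ind: B => p' q' r' s'.
elim/mx2_ind: C => p2 q2 r2 s2.
rewrite !mx2rE; ring.
Qed.

Lemma tr_untwistY_x A B C :
  \tr (A *m (B *m C *m B *m adj2 (B *m C))) =
    \tr A * \tr B * (\det B * \det C) + \tr C * \tr (A *m B *m C) * \det B
    - \tr (B *m C) * \tr (A *m B *m C *m adj2 B)
    - \det B * \det C * \tr (A *m B).
Proof.
elim/mx2_ind: A => p q r s; elim/mx2_ind: B => p' q' r' s'.
elim/mx2_ind: C => p2 q2 r2 s2.
rewrite !mx2rE; ring.
Qed.

End Matrices2.

(** * The action of the Dehn twists on representations *)

Section InverseTwists.
Variable R : realType.
Local Notation space := (R * R * R)%type.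
Local Notation bdata := (R * R * R * R)%type.

Definition untauX (B : bdata) (p : space) : space :=
  let: (a, b, c, d) := B in
  let: (x, y, z) := p in
  let y' := a * d + b * c - x * z - y in
  (x, y', a * c + b * d - x * y' - z).

Definition untauY (B : bdata) (p : space) : space :=
  let: (a, b, c, d) := B in
  let: (x, y, z) := p in
  let z' := a * c + b * d - x * y - z in
  (a * b + c * d - y * z' - x, y, z').

Lemma tauXK B : cancel (tauX B) (untauX B).
Proof.
by case: B => -[[a b] c] d [[x y] z] /=; congr (_, _, _); ring.
Qed.

Lemma untauXK B : cancel (untauX B) (tauX B).
Proof.
by case: B => -[[a b] c] d [[x y] z] /=; congr (_, _, _); ring.
Qed.

Lemma tauYK B : cancel (tauY B) (untauY B).
Proof.
by case: B => -[[a b] c] d [[x y] z] /=; congr (_, _, _); ring.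
Qed.

Lemma untauYK B : cancel (untauY B) (tauY B).
Proof.
by case: B => -[[a b] c] d [[x y] z] /=; congr (_, _, _); ring.
Qed.

End InverseTwists.

Section Twists.
Variable F : fieldType.
Implicit Types (rho : quad F) (V : 'M[F]_2).

Definition twistX rho : quad F :=
  let X := imA rho *m imB rho in
  Quad (imA rho) (imB rho) (X *m imC rho *m adj2 X) (X *m imD rho *m adj2 X).

Definition untwistX rho : quad F :=
  let X := imA rho *m imB rho in
  Quad (imA rho) (imB rho) (adj2 X *m imC rho *m X) (adj2 X *m imD rho *m X).

Definition twistY rho : quad F :=
  let Y := imB rho *m imC rho in
  Quad (imA rho) (adj2 Y *m imB rho *m Y) (adj2 Y *m imC rho *m Y) (imD rho).

Definition untwistY rho : quad F :=
  let Y := imB rho *m imC rho in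
  Quad (imA rho) (Y *m imB rho *m adj2 Y) (Y *m imC rho *m adj2 Y) (imD rho).

Lemma stablemx_trM V (M N : 'M[F]_2) :
  stablemx V M^T -> stablemx V N^T -> stablemx V (M *m N)^T.
Proof. by move=> VM VN; rewrite trmx_mul stablemxM. Qed.

Lemma stablemx_tr_adj2 V (M : 'M[F]_2) :
  stablemx V M^T -> stablemx V (adj2 M)^T.
Proof.
by move=> VM; rewrite /adj2 linearB /= tr_scalar_mx stablemxD ?stablemxC ?stablemxN.
Qed.

Lemma invariant_twistX rho V :
  invariant_space rho V -> invariant_space (twistX rho) V.
Proof.
case: rho => A B C D /and4P[/= HA HB HC HD]; apply/and4P => /=.
by split=> //; rewrite !(stablemx_trM, stablemx_tr_adj2).
Qed.

Lemma invariant_untwistX rho V :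
  invariant_space rho V -> invariant_space (untwistX rho) V.
Proof.
case: rho => A B C D /and4P[/= HA HB HC HD]; apply/and4P => /=.
by split=> //; rewrite !(stablemx_trM, stablemx_tr_adj2).
Qed.

Lemma invariant_twistY rho V :
  invariant_space rho V -> invariant_space (twistY rho) V.
Proof.
case: rho => A B C D /and4P[/= HA HB HC HD]; apply/and4P => /=.
by split=> //; rewrite !(stablemx_trM, stablemx_tr_adj2).
Qed.

Lemma invariant_untwistY rho V :
  invariant_space rho V -> invariant_space (untwistY rho) V.
Proof.
case: rho => A B C D /and4P[/= HA HB HC HD]; apply/and4P => /=.
by split=> //; rewrite !(stablemx_trM, stablemx_tr_adj2).
Qed.

Lemma conj_adj2K (X M : 'M[F]_2) : \det X = 1 ->
  adj2 X *m (X *m M *m adj2 X) *m X = M.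
Proof.
move=> dX; rewrite -!mulmxA adj2_mul dX mulmx1 mulmxA adj2_mul dX.
by rewrite mul1mx.
Qed.

Lemma conj_adj2KV (X M : 'M[F]_2) : \det X = 1 ->
  X *m (adj2 X *m M *m X) *m adj2 X = M.
Proof. by move=> dX; have := @conj_adj2K (adj2 X) M; rewrite adj2K det_adj2; apply. Qed.

Lemma conj_mul2 (X M N : 'M[F]_2) : \det X = 1 ->
  (X *m M *m adj2 X) *m (X *m N *m adj2 X) = X *m (M *m N) *m adj2 X.
Proof.
move=> dX; rewrite -!mulmxA; do 2 congr (_ *m _).
by rewrite mulmxA adj2_mul dX mul1mx.
Qed.

Lemma conjV_mul2 (X M N : 'M[F]_2) : \det X = 1 ->
  (adj2 X *m M *m X) *m (adj2 X *m N *m X) = adj2 X *m (M *m N) *m X.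
Proof.
by move=> dX; have := @conj_mul2 (adj2 X) M N; rewrite adj2K det_adj2; apply.
Qed.

Lemma twistXK rho : \det (imA rho) = 1 -> \det (imB rho) = 1 ->
  untwistX (twistX rho) = rho.
Proof.
by case: rho => A B C D /= dA dB; rewrite /untwistX /= !conj_adj2K //
  det_mulmx dA dB mulr1.
Qed.

Lemma untwistXK rho : \det (imA rho) = 1 -> \det (imB rho) = 1 ->
  twistX (untwistX rho) = rho.
Proof.
by case: rho => A B C D /= dA dB; rewrite /twistX /= !conj_adj2KV //
  det_mulmx dA dB mulr1.
Qed.

Lemma twistYK rho : \det (imB rho) = 1 -> \det (imC rho) = 1 ->
  untwistY (twistY rho) = rho.
Proof.
case: rho => A B C D /= dB dC.
have dY : \det (B *m C) = 1 by rewrite det_mulmx dB dC mulr1.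
by rewrite /untwistY /= conjV_mul2 // adj2_mul dY mul1mx !conj_adj2KV.
Qed.

Lemma untwistYK rho : \det (imB rho) = 1 -> \det (imC rho) = 1 ->
  twistY (untwistY rho) = rho.
Proof.
case: rho => A B C D /= dB dC.
have dY : \det (B *m C) = 1 by rewrite det_mulmx dB dC mulr1.
rewrite /twistY /= conj_mul2 // -[_ *m _ *m adj2 _]mulmxA mul_adj2 dY mulmx1.
by rewrite !conj_adj2K.
Qed.

(** Complete reducibility depends only on which subspaces are invariant. A twist replaces the images
    by words in them, and its inverse does the same, so both quadruples have the same invariant
    subspaces. *)
Lemma completely_reducible_invariant rho rho' :
  (forall V, invariant_space rho V -> invariant_space rho' V) ->
  (forall V, invariant_space rho' V -> invariant_space rho V) ->
  completely_reducible rho -> completely_reducible rho'.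
Proof.
move=> H H' cr V /H' /cr[W [iW dW cW]]; exists W; split=> //; exact: H.
Qed.

Variable G : set 'M[F]_2.
Hypothesis G_det : forall g, G g -> \det g = 1.
Hypothesis G_mul : forall g h, G g -> G h -> G (g *m h).
Hypothesis G_adj : forall g, G g -> G (adj2 g).

Lemma twistX_completely_reducible rho : representation G rho ->
  completely_reducible rho -> completely_reducible (twistX rho).
Proof.
case=> /G_det dA /G_det dB _ _ _.
apply: completely_reducible_invariant => V; first exact: invariant_twistX.
by move/invariant_untwistX; rewrite twistXK.
Qed.

Lemma untwistX_completely_reducible rho : representation G rho ->
  completely_reducible rho -> completely_reducible (untwistX rho).
Proof.
case=> /G_det dA /G_det dB _ _ _.
apply: completely_reducible_invariant => V; first exact: invariant_untwistX.
by move/invariant_twistX; rewrite untwistXK.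
Qed.

Lemma twistY_completely_reducible rho : representation G rho ->
  completely_reducible rho -> completely_reducible (twistY rho).
Proof.
case=> _ /G_det dB /G_det dC _ _.
apply: completely_reducible_invariant => V; first exact: invariant_twistY.
by move/invariant_untwistY; rewrite twistYK.
Qed.

Lemma untwistY_completely_reducible rho : representation G rho ->
  completely_reducible rho -> completely_reducible (untwistY rho).
Proof.
case=> _ /G_det dB /G_det dC _ _.
apply: completely_reducible_invariant => V; first exact: invariant_untwistY.
by move/invariant_twistY; rewrite untwistYK.
Qed.

Lemma representation_twistX rho :
  representation G rho -> representation G (twistX rho).
Proof.
case: rho => A B C D [/= GA GB GC GD E]; have GX := G_mul GA GB.
split=> //=; try by do !apply: G_mul => //; exact: G_adj.
rewrite -mulmxA conj_mul2 ?G_det //.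
have -> : A *m B *m (C *m D) = 1%:M by rewrite !mulmxA.
by rewrite mul1mx mul_adj2 G_det.
Qed.

Lemma representation_untwistX rho :
  representation G rho -> representation G (untwistX rho).
Proof.
case: rho => A B C D [/= GA GB GC GD E]; have GX := G_mul GA GB.
split=> //=; try by do !apply: G_mul => //; exact: G_adj.
rewrite -mulmxA conjV_mul2 ?G_det // !mulmxA mul_adj2 G_det // mul1mx.
by rewrite -mulmxA; apply: mulmx1C; rewrite !mulmxA.
Qed.

Lemma representation_twistY rho :
  representation G rho -> representation G (twistY rho).
Proof.
case: rho => A B C D [/= GA GB GC GD E]; have GY := G_mul GB GC.
split=> //=; try by do !apply: G_mul => //; exact: G_adj.
rewrite -[X in X *m _ = _]mulmxA conjV_mul2 ?G_det // adj2_mul G_det // mul1mx.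
by rewrite !mulmxA.
Qed.

Lemma representation_untwistY rho :
  representation G rho -> representation G (untwistY rho).
Proof.
case: rho => A B C D [/= GA GB GC GD E]; have GY := G_mul GB GC.
split=> //=; try by do !apply: G_mul => //; exact: G_adj.
rewrite -[X in X *m _ = _]mulmxA conj_mul2 ?G_det //.
rewrite -[_ *m _ *m adj2 _]mulmxA mul_adj2 G_det // mulmx1.
by rewrite !mulmxA.
Qed.

Lemma tr_conj_adj2 (X M : 'M[F]_2) : \det X = 1 -> \tr (X *m M *m adj2 X) = \tr M.
Proof. by move=> dX; rewrite mxtrace_mulC mulmxA adj2_mul dX mul1mx. Qed.

Lemma tr_conjV_adj2 (X M : 'M[F]_2) : \det X = 1 -> \tr (adj2 X *m M *m X) = \tr M.
Proof. by move=> dX; rewrite mxtrace_mulC mulmxA mul_adj2 dX mul1mx. Qed.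

(** The image of D is inverse to that of ABC, and a matrix of determinant 1 has the same trace as
    its inverse. *)
Lemma representation_tr rho : representation G rho ->
  \tr (imD rho) = \tr (imA rho *m imB rho *m imC rho).
Proof.
case=> GA GB GC GD E.
have dM := G_det (G_mul (G_mul GA GB) GC).
rewrite -[imD rho]mul1mx -[X in X%:M]dM -adj2_mul -mulmxA E mulmx1.
exact: tr_adj2.
Qed.

Variables (R : realType) (j : {rmorphism R -> F}).

Lemma moduli_surface a b c d x y z : moduli j G (a, b, c, d) (x, y, z) ->
  x ^+ 2 + y ^+ 2 + z ^+ 2 + x * y * z
  = (a * b + c * d) * x + (a * d + b * c) * y + (a * c + b * d) * z
    - (a ^+ 2 + b ^+ 2 + c ^+ 2 + d ^+ 2 + a * b * c * d - 4).
Proof.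
case=> rho [rep _ [ta tb tc td]] [tx ty tz].
have := representation_tr rep; rewrite td; case: (rep) => GA GB GC _ _.
have := fricke_relation (imA rho) (imB rho) (imC rho).
rewrite !G_det // ta tb tc tx ty tz => H dE; rewrite -dE in H.
(* A field morphism is injective, so the relation may be checked in [F]. *)
apply/eqP; rewrite -(fmorph_eq j); apply/eqP.
rewrite !(rmorphXn, rmorph_nat, rmorphB, rmorphD, rmorphM).
by move: H; rewrite !mulr1.
Qed.

Lemma moduli_tauX B p : moduli j G B p -> moduli j G B (tauX B p).
Proof.
case: B p => -[[a b] c] d -[[x y] z] [rho [rep cr [ta tb tc td]] [tx ty tz]].
have trD := representation_tr rep; rewrite td in trD.
have [GA GB GC GD E] := rep; have GX := G_mul GA GB.
exists (twistX rho); first split.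
- exact: representation_twistX.
- exact: twistX_completely_reducible.
- by rewrite /= !tr_conj_adj2 ?G_det.
have zE : \tr (imA rho *m imB rho *m imC rho *m adj2 (imB rho))
    = j (a * c + b * d - x * y - z).
  rewrite tr_twistX_z !G_det // ta tb tc tx ty tz -trD.
  by rewrite !(rmorphD, rmorphB, rmorphM, rmorphN); ring.
split=> //=.
- rewrite tr_twistX_y !G_det // zE ta tb tc tx ty -trD.
  by rewrite !(rmorphD, rmorphB, rmorphM, rmorphN); ring.
- rewrite -zE adj2M -!mulmxA adj2_mul G_det // mulmx1.
  by rewrite !mulmxA.
Qed.

Lemma moduli_tauY B p : moduli j G B p -> moduli j G B (tauY B p).
Proof.
case: B p => -[[a b] c] d -[[x y] z] [rho [rep cr [ta tb tc td]] [tx ty tz]].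
have trD := representation_tr rep; rewrite td in trD.
have [GA GB GC GD E] := rep; have GY := G_mul GB GC.
exists (twistY rho); first split.
- exact: representation_twistY.
- exact: twistY_completely_reducible.
- by rewrite /= !tr_conjV_adj2 ?G_det.
have xE : \tr (imA rho *m (adj2 (imC rho) *m imB rho *m imC rho))
    = j (a * b + c * d - y * z - x).
  rewrite tr_twistY_x !G_det // ta tb tc tx ty tz -trD.
  by rewrite !(rmorphD, rmorphB, rmorphM, rmorphN); ring.
split=> /=.
- rewrite -xE adj2M -!mulmxA [adj2 (imB _) *m _]mulmxA adj2_mul G_det //.
  by rewrite mul1mx.
- by rewrite conjV_mul2 ?G_det // adj2_mul G_det // mul1mx.
- rewrite tr_twistY_z !G_det // xE ta tb tc ty tz -trD.
  by rewrite !(rmorphD, rmorphB, rmorphM, rmorphN); ring.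
Qed.

Lemma moduli_untauX B p : moduli j G B p -> moduli j G B (untauX B p).
Proof.
case: B p => -[[a b] c] d -[[x y] z] [rho [rep cr [ta tb tc td]] [tx ty tz]].
have trD := representation_tr rep; rewrite td in trD.
have [GA GB GC GD E] := rep; have GX := G_mul GA GB.
exists (untwistX rho); first split.
- exact: representation_untwistX.
- exact: untwistX_completely_reducible.
- by rewrite /= !tr_conjV_adj2 ?G_det.
have yE : \tr (imB rho *m (adj2 (imA rho) *m imC rho *m imA rho))
    = j (a * d + b * c - x * z - y).
  (* The identity is used with (A, B, C) cyclically permuted to (B, C, A). *)
  rewrite tr_twistY_x !G_det //.
  rewrite [\tr (imB rho *m imC rho *m imA rho)]mxtrace_mulC mulmxA.
  rewrite ta tb tc tx ty tz -trD.
  by rewrite !(rmorphD, rmorphB, rmorphM, rmorphN); ring.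
split=> //=.
- rewrite -yE adj2M !mulmxA mul_adj2 G_det // mul1mx mxtrace_mulC.
  by rewrite !mulmxA.
- rewrite tr_untwistX_z !G_det // yE ta tb tc tx tz -trD.
  by rewrite !(rmorphD, rmorphB, rmorphM, rmorphN); ring.
Qed.

Lemma moduli_untauY B p : moduli j G B p -> moduli j G B (untauY B p).
Proof.
case: B p => -[[a b] c] d -[[x y] z] [rho [rep cr [ta tb tc td]] [tx ty tz]].
have trD := representation_tr rep; rewrite td in trD.
have [GA GB GC GD E] := rep; have GY := G_mul GB GC.
exists (untwistY rho); first split.
- exact: representation_untwistY.
- exact: untwistY_completely_reducible.
- by rewrite /= !tr_conj_adj2 ?G_det.
have zE : \tr (imA rho *m imB rho *m imC rho *m adj2 (imB rho))
    = j (a * c + b * d - x * y - z).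
  rewrite tr_twistX_z !G_det // ta tb tc tx ty tz -trD.
  by rewrite !(rmorphD, rmorphB, rmorphM, rmorphN); ring.
split=> /=.
- rewrite tr_untwistY_x !G_det // zE ta tb tc tx ty -trD.
  by rewrite !(rmorphD, rmorphB, rmorphM, rmorphN); ring.
- by rewrite conj_mul2 ?G_det // tr_conj_adj2 ?G_det.
- rewrite -zE adj2M !mulmxA -[_ *m imC rho *m adj2 (imC rho)]mulmxA mul_adj2.
  by rewrite G_det // mulmx1 mxtrace_mulC !mulmxA.
Qed.

End Twists.

(** * Representations in SU(2) and SL(2, R) *)

Section SU2_traces.
Variable R : realType.

Lemma SU2_det (g : 'M[R[i]]_2) : @SU2 R g -> \det g = 1.
Proof. by case. Qed.

Lemma SU2_adj2E (g : 'M[R[i]]_2) : @SU2 R g -> adj2 g = (g^t* )%sesqui.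
Proof.
case=> /unitarymxP gg dg.
by rewrite -[RHS]mul1mx -[X in X%:M]dg -adj2_mul -mulmxA gg mulmx1.
Qed.

Lemma SU2_adj (g : 'M[R[i]]_2) : @SU2 R g -> @SU2 R (adj2 g).
Proof.
move=> Gg; split; last by rewrite det_adj2 SU2_det.
by rewrite SU2_adj2E // trmxC_unitary; case: Gg.
Qed.

Lemma SU2_mul (g h : 'M[R[i]]_2) : @SU2 R g -> @SU2 R h -> @SU2 R (g *m h).
Proof.
move=> [ug dg] [uh dh]; split; last by rewrite det_mulmx dg dh mulr1.
exact: mul_unitarymx.
Qed.

(** The equality of inverse and conjugate transpose makes the diagonal entries conjugate, say p and
    its conjugate. The trace is then twice the real part of p, and |p| <= 1 by the determinant. *)
Lemma SU2_tr_le2 (g : 'M[R[i]]_2) (t : R) :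
  @SU2 R g -> \tr g = t%:C%C -> t <= 2.
Proof.
move=> Gg; have := SU2_adj2E Gg; move: (SU2_det Gg).
elim/mx2_ind: g {Gg} => -[p1 p2] [q1 q2] [r1 r2] [s1 s2].
rewrite !mx2rE => dg /matrixP E.
have := E 0 0; have := E 0 1; rewrite !mxE /= => -[E1 E2] [E3 E4].
move: dg => -[D1 _] [T1 _]; nra.
Qed.

(** The trace, minus 2, of the commutator of two matrices of determinant 1 with traces [a] and [b]
    and product of trace [x]. *)
Definition kappa (a b x : R) := x ^+ 2 - a * b * x + a ^+ 2 + b ^+ 2 - 4.

(** The commutators of A with B and of C with D lie in SU(2), hence have trace at most 2. *)
Lemma moduli_SU2_kappa a b c d x y z : moduli_SU2 (a, b, c, d) (x, y, z) ->
  kappa a b x <= 0 /\ kappa c d x <= 0.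
Proof.
case=> rho [rep _ [ta tb tc td]] [tx _ _].
have key A B (u v : R) : @SU2 R A -> @SU2 R B -> \tr A = u%:C%C ->
    \tr B = v%:C%C -> \tr (A *m B) = x%:C%C -> kappa u v x <= 0.
  move=> GA GB tA tB tAB.
  have GK := SU2_mul (SU2_mul (SU2_mul GA GB) (SU2_adj GA)) (SU2_adj GB).
  have := @SU2_tr_le2 _ (kappa u v x + 2) GK; rewrite tr_commutator.
  rewrite !SU2_det // tA tB tAB => H.
  suff: kappa u v x + 2 <= 2 by lra.
  apply: H; rewrite /kappa.
  rewrite !(rmorphXn, rmorph_nat, rmorphB, rmorphD, rmorphM).
  ring.
have [GA GB GC GD E] := rep; split; first exact: key ta tb tx.
apply: (key _ _ _ _ GC GD tc td).
(* CD is the inverse of AB, so it also has trace [x]. *)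
rewrite -tx -[RHS]tr_adj2; congr (\tr _); have GX := SU2_mul GA GB.
rewrite -[LHS]mul1mx -[X in X%:M](SU2_det GX) -adj2_mul -mulmxA.
have -> : imA rho *m imB rho *m (imC rho *m imD rho) = 1%:M by rewrite !mulmxA.
by rewrite mulmx1.
Qed.

End SU2_traces.

(** * Real matrices with prescribed traces *)

Section SL2R_realization.
Variable R : realType.

Lemma SL2R_mul (g h : 'M[R]_2) : @SL2R R g -> @SL2R R h -> @SL2R R (g *m h).
Proof. by rewrite /SL2R /= det_mulmx => -> ->; rewrite mulr1. Qed.

Lemma SL2R_adj (g : 'M[R]_2) : @SL2R R g -> @SL2R R (adj2 g).
Proof. by rewrite /SL2R /= det_adj2. Qed.

(** An elliptic real matrix has no real eigenvector, so a nonzero invariant subspace contains two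
    independent vectors [v] and [w], the image of [v]. *)
Lemma elliptic_completely_reducible (rho : quad R) :
  \det (imA rho) = 1 -> -2 < \tr (imA rho) < 2 -> completely_reducible rho.
Proof.
move=> dA tA V /and4P[VA VB VC VD].
have [V0|Vn0] := eqVneq V 0.
  exists 1%:M; rewrite V0; split; [|exact: adds0mx|exact: cap0mx].
  by apply/and4P; split; apply: stablemx_unit; exact: unitmx1.
have {Vn0} /rowV0Pn[v vV vn0] := Vn0.
suff fV : row_full V.
  exists 0; split; last exact: capmx0.
    by apply/and4P; rewrite !mul0mx !sub0mx.
  apply: eqmx_trans (addsmx0 _ _) _.
  by apply/eqmxP; rewrite submx1 sub1mx.
rewrite -sub1mx.
have wV : (v *m (imA rho)^T <= V)%MS.
  by apply: submx_trans VA; exact: submxMr.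
have [w wdef] : exists w, w = v *m (imA rho)^T by exists (v *m (imA rho)^T).
rewrite -wdef in wV.
have MV : (mx2 (v 0 0) (v 0 1) (w 0 0) (w 0 1) <= V)%MS.
  apply/row_subP => -[[|[|//]] Hi].
    congr (_ <= V)%MS: vV; apply/rowP => -[[|[|//]] Hj]; rewrite !mxE /=;
    by congr (v _ _); apply: val_inj.
  congr (_ <= V)%MS: wV; apply/rowP => -[[|[|//]] Hj]; rewrite !mxE /=;
  by congr (w _ _); apply: val_inj.
apply: submx_trans MV; rewrite sub1mx row_full_unit unitmxE unitfE.
have {}vn0 : (v 0 0 != 0) || (v 0 1 != 0).
  apply: contraNT vn0; rewrite negb_or !negbK => /andP[/eqP v0 /eqP v1].
  apply/eqP/rowP => -[[|[|//]] Hj]; rewrite mxE.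
    by rewrite -[RHS]v0; congr (v _ _); apply: val_inj.
  by rewrite -[RHS]v1; congr (v _ _); apply: val_inj.
have wE k : w 0 k = v 0 0 * imA rho k 0 + v 0 1 * imA rho k 1.
  rewrite wdef mxE !big_ord_recl big_ord0 !mxE addr0; congr (_ * _ + v _ _ * imA rho _ _);
    exact: val_inj.
rewrite detmx2 !wE; move: dA tA; elim/mx2_ind: (imA rho) => p q r s.
rewrite detmx2 trmx2 !mxE /= => dA /andP[tA1 tA2].
move: (v 0 0) (v 0 1) vn0 => v0 v1 vn0.
(* The determinant of [v] and [w] is a quadratic form in [v]; its discriminant, the squared trace
   minus 4, is negative, so it vanishes only at 0. *)
have disc : (s - p) ^+ 2 + 4 * (q * r) < 0.
  rewrite [X in X < 0](_ : _ = (p + s) ^+ 2 - 4); last by move: dA; lra.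
  nra.
apply/negP => /eqP H.
have H1 : v0 ^+ 2 * ((s - p) ^+ 2 + 4 * (q * r)) =
    (v0 * (s - p) - 2 * q * v1) ^+ 2.
  by apply/eqP; rewrite -subr_eq0 -[X in _ == X](mulr0 (4 * q)) -H; apply/eqP; ring.
have H2 : v1 ^+ 2 * ((s - p) ^+ 2 + 4 * (q * r)) =
    (v1 * (s - p) + 2 * r * v0) ^+ 2.
  by apply/eqP; rewrite -subr_eq0 -[X in _ == X](mulr0 (- 4 * r)) -H; apply/eqP; ring.
have sq0 (t e : R) : t ^+ 2 * ((s - p) ^+ 2 + 4 * (q * r)) = e ^+ 2 -> t = 0.
  move=> E; apply/eqP; apply: contraT => t0.
  have : 0 < t ^+ 2 by rewrite exprn_even_gt0.
  have : 0 <= e ^+ 2 by exact: sqr_ge0.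
  rewrite -E; nra.
by move: vn0; rewrite (sq0 _ _ H1) (sq0 _ _ H2) eqxx.
Qed.

(** A is taken to be a rotation and B is built from its trace, its determinant and the trace of AB;
    here [4 * s ^+ 2 * u ^+ 2 = kappa a b x], whence the positivity hypothesis. C is then the
    solution of linear trace equations. *)
Lemma SL2R_realize (a b c d x y z : R) : -2 < a < 2 -> 0 < kappa a b x ->
  x ^+ 2 + y ^+ 2 + z ^+ 2 + x * y * z
  = (a * b + c * d) * x + (a * d + b * c) * y + (a * c + b * d) * z
    - (a ^+ 2 + b ^+ 2 + c ^+ 2 + d ^+ 2 + a * b * c * d - 4) ->
  moduli_SL2R (a, b, c, d) (x, y, z).
Proof.
move=> /andP[a1 a2] kx S.
have sa : 0 < 1 - a ^+ 2 / 4 by nra.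
(* [s] is the sine of the rotation A. Below, [w] is chosen for [\tr (A *m B) = x] and [u] for
   [\det B = 1]. *)
set s := Num.sqrt (1 - a ^+ 2 / 4).
have s0 : 0 < s by rewrite sqrtr_gt0.
have s2 : s ^+ 2 = 1 - a ^+ 2 / 4 by rewrite sqr_sqrtr // ltW.
pose w := (a * b / 2 - x) / (2 * s).
have ws : 2 * s * w = a * b / 2 - x by rewrite /w mulrC divfK //; lra.
have ub : 0 < w ^+ 2 + b ^+ 2 / 4 - 1.
  have E : 4 * s ^+ 2 * (w ^+ 2 + b ^+ 2 / 4 - 1) = kappa a b x.
    rewrite mulrBr mulrDr -[4 * _ * w ^+ 2](_ : (2 * s * w) ^+ 2 = _); last by ring.
    by rewrite ws s2 /kappa; field.
  nra.
set u := Num.sqrt (w ^+ 2 + b ^+ 2 / 4 - 1).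
have u0 : 0 < u by rewrite sqrtr_gt0.
have u2 : u ^+ 2 = w ^+ 2 + b ^+ 2 / 4 - 1 by rewrite sqr_sqrtr // ltW.
(* [w2], [u2'] and [v2] solve in turn the equations for the traces of CA, BC and ABC. *)
pose w2 := (a * c / 2 - z) / (2 * s).
pose u2' := (y - b * c / 2 + 2 * w * w2) / (2 * u).
pose v2 := (d - x * c / 2 - a * u * u2' + (a * w + s * b) * w2) / (2 * s * u).
have w2E : 2 * s * w2 = a * c / 2 - z by rewrite /w2 mulrC divfK //; lra.
have u2E : 2 * u * u2' = y - b * c / 2 + 2 * w * w2.
  by rewrite /u2' mulrC divfK //; lra.
have v2E : 2 * s * u * v2 = d - x * c / 2 - a * u * u2' + (a * w + s * b) * w2.
  by rewrite /v2 mulrC divfK // mulf_neq0 //; lra.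
pose A := mx2 (a / 2) (- s) s (a / 2).
pose B := mx2 (b / 2 + u) (- w) w (b / 2 - u).
pose C := mx2 (c / 2 + u2') (v2 - w2) (v2 + w2) (c / 2 - u2').
have dA : \det A = 1 by rewrite detmx2; move: s2; lra.
have dB : \det B = 1 by rewrite detmx2; move: u2; lra.
have tA : \tr A = a by rewrite trmx2; field.
have tB : \tr B = b by rewrite trmx2; field.
have tC : \tr C = c by rewrite trmx2; field.
have tAB : \tr (A *m B) = x by rewrite mulmx2 trmx2; move: ws; lra.
have tBC : \tr (B *m C) = y by rewrite mulmx2 trmx2; move: u2E; lra.
have tCA : \tr (C *m A) = z by rewrite mulmx2 trmx2; move: w2E; lra.
have tABC : \tr (A *m B *m C) = d.
  rewrite !mulmx2 trmx2.
  move: v2E; rewrite -[x in x * c]tAB mulmx2 trmx2; lra.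
(* In the Fricke relation the coefficient of [\det C] is [kappa a b x] once the traces are
   prescribed, so the surface equation forces the determinant. *)
have dC : \det C = 1.
  have := fricke_relation A B C; rewrite dA dB tA tB tC tAB tBC tCA tABC => H.
  have : (\det C - 1) * kappa a b x = 0 by rewrite /kappa; move: H S; lra.
  by move/eqP; rewrite mulf_eq0 (gt_eqF kx) orbF subr_eq0 => /eqP.
exists (Quad A B C (adj2 (A *m B *m C))); last by [].
have dABC : \det (A *m B *m C) = 1 by rewrite !det_mulmx dA dB dC !mulr1.
split=> //=; last by rewrite tr_adj2.
- by split=> //=; rewrite /SL2R /= ?det_adj2 // mul_adj2 dABC.
- by apply: elliptic_completely_reducible; rewrite /= ?tA ?a1.
Qed.

End SL2R_realization.

(** * The cubic surface and the compact components *)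

Section ContinuityRules.
Variables (T U V : topologicalType) (R : realType).
Local Notation cont f t := {for t, continuous f} (only parsing).
Implicit Types (f g : T -> R) (t : T).

Lemma cont_id t : cont (fun x : T => x) t.
Proof. exact: cvg_id. Qed.

Lemma cont_cst (u : U) t : cont (fun _ : T => u) t.
Proof. exact: cvg_cst. Qed.

Lemma contD f g t : cont f t -> cont g t -> cont (fun x => f x + g x) t.
Proof. exact: cvgD. Qed.

Lemma contN f t : cont f t -> cont (fun x => - f x) t.
Proof. exact: cvgN. Qed.

Lemma contM f g t : cont f t -> cont g t -> cont (fun x => f x * g x) t.
Proof. exact: cvgM. Qed.

Lemma contX f n t : cont f t -> cont (fun x => f x ^+ n) t.
Proof.
move=> cf.
exact: (@continuous_comp _ _ _ f (fun u : R => u ^+ n) t cf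
  (@exprn_continuous R n _)).
Qed.

Lemma cont_sqrt f t : cont f t -> cont (fun x => Num.sqrt (f x)) t.
Proof.
move=> cf.
exact: (@continuous_comp _ _ _ f (@Num.sqrt R) t cf
  (@sqrt_continuous R _)).
Qed.

Lemma contV f t : f t != 0 -> cont f t -> cont (fun x => (f x)^-1) t.
Proof. by move=> f0 cf; exact: cvgV. Qed.

Lemma cont_cos f t : cont f t -> cont (fun x => cos (f x)) t.
Proof.
move=> cf.
exact: (@continuous_comp _ _ _ f (@cos R) t cf
  (@continuous_cos R _)).
Qed.

Lemma cont_sin f t : cont f t -> cont (fun x => sin (f x)) t.
Proof.
move=> cf.
exact: (@continuous_comp _ _ _ f (@sin R) t cf
  (@continuous_sin R _)).
Qed.

Lemma cont_fst (p : T -> U * V) t : cont p t -> cont (fun x => (p x).1) t.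
Proof.
move=> cp.
by apply: (@continuous_comp _ _ _ p fst t cp); exact: cvg_fst.
Qed.

Lemma cont_snd (p : T -> U * V) t : cont p t -> cont (fun x => (p x).2) t.
Proof.
move=> cp.
by apply: (@continuous_comp _ _ _ p snd t cp); exact: cvg_snd.
Qed.

Lemma cont_pair (p : T -> U) (q : T -> V) t : cont p t -> cont q t ->
  cont (fun x => (p x, q x)) t.
Proof. by move=> cp cq; exact: cvg_pair. Qed.

Lemma cont_pairl (u : U) (v : V) : {for v, continuous (pair u : V -> U * V)}.
Proof. by apply: cvg_pair; [exact: cvg_cst|exact: cvg_id]. Qed.

End ContinuityRules.

Lemma cont_mull (R : realType) (c t : R) :
  {for t, continuous (GRing.mul c : R -> R)}.
Proof. by apply: cvgM; [exact: cvg_cst|exact: cvg_id]. Qed.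

Lemma cont_addl (R : realType) (c t : R) :
  {for t, continuous (GRing.add c : R -> R)}.
Proof. by apply: cvgD; [exact: cvg_cst|exact: cvg_id]. Qed.

Ltac cts := lazymatch goal with
  | |- {for _, continuous (fun x => x)} => apply: cont_id
  | |- {for _, continuous (fun _ => ?c)} => apply: cont_cst
  | |- {for _, continuous (fun x => (@?f x, @?g x))} => apply: cont_pair; cts
  | |- {for _, continuous (fun x => @?f x + @?g x)} => apply: contD; cts
  | |- {for _, continuous (fun x => - @?f x)} => apply: contN; cts
  | |- {for _, continuous (fun x => @?f x * @?g x)} => apply: contM; cts
  | |- {for _, continuous (fun x => @?f x ^+ _)} => apply: contX; cts
  | |- {for _, continuous (fun x => Num.sqrt (@?f x))} => apply: cont_sqrt; cts
  | |- {for _, continuous (fun x => (@?f x)^-1)} => apply: contV; [|cts]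
  | |- {for _, continuous (fun x => cos (@?f x))} => apply: cont_cos; cts
  | |- {for _, continuous (fun x => sin (@?f x))} => apply: cont_sin; cts
  | |- {for _, continuous (fun x => fst (@?f x))} => apply: cont_fst; cts
  | |- {for _, continuous (fun x => snd (@?f x))} => apply: cont_snd; cts
  (* the eta-contracted forms produced by unification *)
  | |- {for _, continuous (GRing.mul ?c)} => apply: cont_mull
  | |- {for _, continuous (GRing.add ?c)} => apply: cont_addl
  | |- {for _, continuous (pair ?c)} => apply: cont_pairl
  | |- {for _, continuous cos} => exact: continuous_cos
  | |- {for _, continuous sin} => exact: continuous_sin
  | |- {for _, continuous fst} => apply: cvg_fst
  | |- {for _, continuous snd} => apply: cvg_snd
  | _ => idtac
  end.

Section Components.
Variables (T : topologicalType) (R : realType).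

Lemma component_contains_arc (M : set T) (I : set R) (g : R -> T) (t : R) :
  is_interval I -> (forall s, I s -> {for s, continuous g}) -> I t ->
  (forall s, I s -> M (g s)) ->
  forall s, I s -> connected_component M (g t) (g s).
Proof.
move=> Ii cg It gM s Is.
apply: (@connected_component_max _ M (g @` I) (g t)); last by exists s.
- by exists t.
- by move=> _ [u Iu <-]; exact: gM.
apply: connected_continuous_connected; first exact/connected_intervalP.
by apply: continuous_in_subspaceT => u; rewrite inE => Iu; exact: cg.
Qed.

Lemma compact_image_bounded (C : set T) (f : T -> R) : compact C ->
  (forall t, {for t, continuous f}) ->
  exists N : R, forall t, C t -> `|f t| <= N.
Proof.
move=> cC cf.
have /compact_bounded[N [_ HN]] : compact (f @` C).
  by apply: continuous_compact => //; apply: continuous_subspaceT => t; exact: cf.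
exists (N + 1) => t Ct; apply: HN; first by rewrite ltrDl.
by exists t.
Qed.

End Components.

(** * The cubic surface as a double cover of the (x, y)-plane *)

Section Surface.
Variable R : realType.
Variables e1 e2 e3 h : R.

Definition surf (x y z : R) : Prop :=
  x ^+ 2 + y ^+ 2 + z ^+ 2 + x * y * z = e1 * x + e2 * y + e3 * z - h.

(* discriminant of the equation of the surface, as a polynomial in z *)
Definition disc (x y : R) := (e3 - x * y) ^+ 2
  - 4 * (x ^+ 2 + y ^+ 2 - e1 * x - e2 * y + h).

(* (4 - x^2) / 4 times the maximum of [disc x] when |x| < 2 *)
Definition level (x : R) := ((2 * e2 - x * e3) ^+ 2
  + (4 - x ^+ 2) * (e3 ^+ 2 - 4 * x ^+ 2 + 4 * e1 * x - 4 * h)) / 4.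

(** Completion of the square in [y]. *)
Lemma disc_level x y : (4 - x ^+ 2) * disc x y =
  4 * level x - ((4 - x ^+ 2) * y - (2 * e2 - x * e3)) ^+ 2.
Proof. by rewrite /disc /level; field. Qed.

Lemma surf_disc x y z : surf x y z -> disc x y = (2 * z - (e3 - x * y)) ^+ 2.
Proof. by rewrite /surf /disc => S; lra. Qed.

Lemma surf_disc_ge0 x y z : surf x y z -> 0 <= disc x y.
Proof. by move/surf_disc => ->; exact: sqr_ge0. Qed.

Lemma disc_surf (e x y : R) : e ^+ 2 = 1 -> 0 <= disc x y ->
  surf x y ((e3 - x * y + e * Num.sqrt (disc x y)) / 2).
Proof.
move=> E D0; have := sqr_sqrtr D0; move: (Num.sqrt _) => s; rewrite /surf => sE.
have : (e * s) ^+ 2 = disc x y by rewrite exprMn E mul1r.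
by move: (e * s) => r; rewrite /disc => rE; lra.
Qed.

Lemma surf_sign x y z : surf x y z ->
  exists2 e : R, e ^+ 2 = 1 &
    z = (e3 - x * y + e * Num.sqrt (disc x y)) / 2.
Proof.
move=> S; rewrite (surf_disc S) sqrtr_sqr; set w := 2 * z - _.
have [w0|w0] := leP 0 w.
  by exists 1; rewrite ?expr1n // (ger0_norm w0) /w; lra.
by exists (-1); rewrite ?sqrrN ?expr1n // (ltr0_norm w0) /w; lra.
Qed.

(* At fixed x with |x| >= 2, the discriminant is a convex function of y, hence
   nonnegative on a half-line. *)
Lemma disc_half_line x y : 2 <= `|x| -> 0 <= disc x y ->
  (forall y', y <= y' -> 0 <= disc x y') \/
  (forall y', y' <= y -> 0 <= disc x y').
Proof.
move=> x2 D0; have x4 : 0 <= x ^+ 2 - 4.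
  by rewrite -(real_normK (num_real x)); nra.
have E y' : disc x y' = disc x y + (y' - y) *
    ((x ^+ 2 - 4) * (y' - y) + (2 * (x ^+ 2 - 4) * y + 4 * e2 - 2 * e3 * x)).
  by rewrite /disc; ring.
have [m|m] := leP 0 (2 * (x ^+ 2 - 4) * y + 4 * e2 - 2 * e3 * x).
  left=> y' yy'; rewrite E; apply: addr_ge0 => //.
  by apply: mulr_ge0; [lra|apply: addr_ge0 => //; apply: mulr_ge0 => //; lra].
right=> y' yy'; rewrite E; apply: addr_ge0 => //.
have : (x ^+ 2 - 4) * (y' - y) <= 0 by apply: mulr_ge0_le0 => //; lra.
by move=> ?; apply: mulr_le0; lra.
Qed.

End Surface.

(** For |x| < 2 the discriminant is a concave function of [y]. *)
Lemma disc_interval (R : realType) (e1 e2 e3 h x : R) : `|x| < 2 ->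
  is_interval [set y | 0 <= disc e1 e2 e3 h x y].
Proof.
move=> x2 u v /= Du Dv w /andP[uw wv].
have x4 : 0 < 4 - x ^+ 2.
  by rewrite -(real_normK (num_real x)); have := normr_ge0 x; nra.
have [uv|uv] := ltP u v; last by rewrite (_ : w = u) //; lra.
suff : 0 <= (v - u) * disc e1 e2 e3 h x w by rewrite pmulr_rge0 // subr_gt0.
rewrite [X in 0 <= X](_ : _ = (w - u) * disc e1 e2 e3 h x v +
    (v - w) * disc e1 e2 e3 h x u + (4 - x ^+ 2) * ((w - u) * (v - w) * (v - u)));
  last by rewrite /disc; ring.
apply: addr_ge0; [apply: addr_ge0|]; do ?apply: mulr_ge0;
  by first [exact: Du|exact: Dv|lra].
Qed.

(** * Abscissae of the compact components in the SL(2, R) case *)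

Section ComponentRange.
Variable R : realType.
Variables a b c d : R.
Local Notation e1 := (a * b + c * d).
Local Notation e2 := (a * d + b * c).
Local Notation e3 := (a * c + b * d).
Local Notation h := (a ^+ 2 + b ^+ 2 + c ^+ 2 + d ^+ 2 + a * b * c * d - 4).

(** This factorization makes the endpoints of the two intervals I the roots of the quartic. *)
Lemma level_kappa x : level e1 e2 e3 h x = kappa a b x * kappa c d x.
Proof. by rewrite /level /kappa; field. Qed.

Lemma moduli_SL2R_surf x y z :
  moduli_SL2R (a, b, c, d) (x, y, z) -> surf e1 e2 e3 h x y z.
Proof.
move=> M; apply: (@moduli_surface R (@SL2R R) _ (@SL2R_mul R) R idfun) M.
by [].
Qed.

Hypothesis a2 : -2 < a < 2.
Hypothesis kappa_gt0 : forall t, 2 <= `|t| -> 0 < kappa a b t.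

Variables x y z : R.
Hypothesis Mp : moduli_SL2R (a, b, c, d) (x, y, z).
Hypothesis compact_p :
  compact (connected_component (moduli_SL2R (a, b, c, d)) (x, y, z)).

Lemma component_y_bounded : exists N : R, forall q : R * R * R,
  connected_component (moduli_SL2R (a, b, c, d)) (x, y, z) q -> `|q.1.2| <= N.
Proof.
by apply: (compact_image_bounded (f := fun q => q.1.2) compact_p) => t; cts.
Qed.

(** If |x| >= 2, one can fix [x] and let [y] run along a half-line on which the discriminant is
    nonnegative; as [kappa a b x > 0], the whole arc lifts to representations and the component is
    unbounded. *)
Lemma compact_component_lt2 : `|x| < 2.
Proof.
rewrite ltNge; apply/negP => x2.
have [N HN] := component_y_bounded.
have S := moduli_SL2R_surf Mp.
have [e ee zE] := surf_sign S.
pose g u := (x, u, (e3 - x * u + e * Num.sqrt (disc e1 e2 e3 h x u)) / 2).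
have cg u : {for u, continuous g} by rewrite /g /disc; cts.
have gy : g y = (x, y, z) by rewrite /g -zE.
have bnd (I : set R) : is_interval I -> I y ->
    (forall u, I u -> 0 <= disc e1 e2 e3 h x u) -> forall u, I u -> `|u| <= N.
  move=> Ii Iy ID u Iu; apply: (HN (g u)); rewrite -gy.
  apply: (component_contains_arc Ii _ Iy _ Iu) => [v _|v Iv]; first exact: cg.
  apply: SL2R_realize => //; first exact: kappa_gt0.
  by apply: disc_surf => //; exact: ID.
have N0 : 0 <= N.
  by apply: le_trans (HN (x, y, z) _); [|exact: connected_component_refl].
have yn := ler_norm y; have y0 := normr_ge0 y.
have [H|H] := disc_half_line x2 (surf_disc_ge0 S).
  suff : `|(`|y| + N + 1)| <= N by rewrite ger0_norm; lra.
  apply: (bnd [set u | y <= u]) => //=; last by lra.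
  by move=> u v /= yu _ w /andP[uw _]; exact: le_trans uw.
suff : `|(- (`|y| + N + 1))| <= N by rewrite normrN ger0_norm; lra.
apply: (bnd [set u | u <= y]) => //=.
  by move=> u v /= _ vy w /andP[_ wv]; exact: le_trans vy.
by have := ler_norm (- y); rewrite normrN; lra.
Qed.

Variable sg : R.
Hypothesis sg2 : sg ^+ 2 = 1.
Hypothesis x2 : `|x| < 2.
Hypothesis e23 : e2 != sg * e3.

(** Otherwise the component is unbounded: move inside the x-section to the y-coordinate of its
    centre, then let [sg * x] tend to 2 while following that coordinate. It diverges, since its
    numerator tends to [2 * (e2 - sg * e3)], which is nonzero. The sign [sg] treats the ends 2 and
    -2 together. *)
Lemma compact_component_side : 0 <= kappa a b x -> -2 < sg * x ->
  ~ (forall t, sg * x < t < 2 ->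
       0 < kappa a b (sg * t) /\ 0 <= kappa c d (sg * t)).
Proof.
move=> k0 sx2 pos; have [N HN] := component_y_bounded.
have S := moduli_SL2R_surf Mp.
have [e ee zE] := surf_sign S.
have sgK t : sg * (sg * t) = t by rewrite mulrA -expr2 sg2 mul1r.
have sg1 : `|sg| = 1.
  by have /eqP := sg2; rewrite sqrf_eq1 => /orP[]/eqP->; rewrite ?normrN normr1.
have sx2' : sg * x < 2.
  by apply: le_lt_trans x2; rewrite -[leRHS]mul1r -sg1 -normrM ler_norm.
pose Z u v := (e3 - u * v + e * Num.sqrt (disc e1 e2 e3 h u v)) / 2.
have t4 t : sg * x <= t < 2 -> 0 < 4 - t ^+ 2 by move=> /andP[]; nra.
have t4' t : 4 - (sg * t) ^+ 2 = 4 - t ^+ 2 by rewrite exprMn sg2 mul1r.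
(* The maximizer of the discriminant at abscissa [sg * t]. *)
pose y0 t := (2 * e2 - sg * t * e3) / (4 - t ^+ 2).
have y0E t : sg * x <= t < 2 ->
    (4 - t ^+ 2) * disc e1 e2 e3 h (sg * t) (y0 t)
      = 4 * (kappa a b (sg * t) * kappa c d (sg * t)).
  move=> /t4 tt; rewrite -level_kappa -t4' disc_level t4'.
  have -> : (4 - t ^+ 2) * y0 t = 2 * e2 - sg * t * e3.
    by rewrite /y0 mulrC divfK // gt_eqF.
  by ring.
have sxx : sg * x <= sg * x < 2 by rewrite lexx.
pose q := (x, y0 (sg * x), Z x (y0 (sg * x))).
have pq : connected_component (moduli_SL2R (a, b, c, d)) (x, y, z) q.
  have x4 := t4 _ sxx; rewrite -t4' sgK in x4.
  have D0 := surf_disc_ge0 S.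
  (* If [kappa a b x] vanishes, [SL2R_realize] does not apply, but the section is then one point and
     [y] is already the central value. *)
  move: k0; rewrite le_eqVlt => /orP[/eqP k0|k0].
    have E := disc_level e1 e2 e3 h x y.
    rewrite level_kappa -k0 mul0r mulr0 sub0r in E.
    have yE : y = y0 (sg * x).
      have : (4 - x ^+ 2) * y - (2 * e2 - x * e3) = 0.
        apply/eqP; rewrite -sqrf_eq0 eq_le sqr_ge0 andbT -oppr_ge0 -E.
        by rewrite mulr_ge0 // ltW.
      have y0x : (4 - x ^+ 2) * y0 (sg * x) = 2 * e2 - x * e3.
        by rewrite /y0 -(t4' (sg * x)) !sgK mulrC divfK // gt_eqF.
      move=> H; apply: (@mulfI _ (4 - x ^+ 2)); first by rewrite gt_eqF.
      by rewrite y0x; lra.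
    by rewrite /q -yE /Z -zE; exact: connected_component_refl.
  pose g u := (x, u, Z x u).
  have cg u : {for u, continuous g} by rewrite /g /Z /disc; cts.
  have <- : g y = (x, y, z) by rewrite /g /Z -zE.
  apply: (component_contains_arc (disc_interval (e1 := e1) (e2 := e2)
    (e3 := e3) (h := h) x2) (fun s _ => cg s) _ _ (s := y0 (sg * x))).
  - exact: D0.
  - move=> u Du; apply: SL2R_realize => //.
    exact: disc_surf.
  - rewrite /= -(pmulr_rge0 _ x4) -{1 2}[x]sgK t4' (y0E _ sxx) sgK.
    have := pmulr_rge0 (disc e1 e2 e3 h x y) x4; rewrite D0 disc_level.
    rewrite level_kappa => E; have := sqr_ge0 ((4 - x ^+ 2) * y - (2 * e2 - x * e3)).
    lra.
have ccE : connected_component (moduli_SL2R (a, b, c, d)) (x, y, z) =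
    connected_component (moduli_SL2R (a, b, c, d)) q.
  exact: same_connected_component.
pose g t := (sg * t, y0 t, Z (sg * t) (y0 t)).
have bnd t : sg * x <= t < 2 -> `|y0 t| <= N.
  move=> tt; apply: (HN (g t)); rewrite ccE.
  have <- : g (sg * x) = q by rewrite /g /q sgK.
  apply: (@component_contains_arc _ _ _ [set t | sg * x <= t < 2]) => //.
  - move=> u v /= /andP[u1 u2] /andP[v1 v2] w /andP[uw wv].
    by rewrite (le_trans u1) // (le_lt_trans wv).
  - move=> s /t4 s4; rewrite /g /Z /disc /y0; cts; by rewrite gt_eqF.
  - move=> s /= ss; have := ss; rewrite le_eqVlt => /andP[/orP[/eqP <-|sxs] s2].
      by rewrite /g sgK; exact: (connected_component_sub pq).
    have [kab kcd] : 0 < kappa a b (sg * s) /\ 0 <= kappa c d (sg * s).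
      by apply: pos; rewrite sxs.
    apply: SL2R_realize => //; apply: disc_surf => //.
    rewrite -(pmulr_rge0 _ (t4 _ ss)) y0E //.
    by rewrite mulr_ge0 // mulr_ge0 // ltW.
have N0 : 0 <= N by apply: le_trans (bnd _ sxx).
have de0 : 0 < `|e2 - sg * e3| by rewrite normr_gt0 subr_eq0.
set de := `|e2 - sg * e3| in de0.
(* At distance [m] from 2, the bound on [y0] would give [2 * de <= (4 * N + |e3|) * m], contrary to
   [m * K <= de]. *)
pose K := 4 * N + `|e3| + 1; have K0 : 0 < K by have := normr_ge0 e3; rewrite /K; lra.
pose m := Num.min (2 - sg * x) (de / K).
have m0 : 0 < m by rewrite lt_min divr_gt0 // subr_gt0 sx2'.
have m1 : m <= 2 - sg * x by rewrite ge_min lexx.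
have m2 : m * K <= de by rewrite -ler_pdivlMr // ge_min lexx orbT.
have tt : sg * x <= 2 - m < 2 by lra.
have := bnd _ tt; have s4 := t4 _ tt; rewrite /y0 normrM normfV (gtr0_norm s4).
rewrite ler_pdivrMr //.
have -> : 2 * e2 - sg * (2 - m) * e3 = 2 * (e2 - sg * e3) + sg * e3 * m by ring.
have := lerB_normD (2 * (e2 - sg * e3)) (sg * e3 * m).
rewrite !normrM sg1 -/de (gtr0_norm m0) mul1r (ger0_norm (_ : 0 <= 2)) // => H1 H2.
have : N * (4 - (2 - m) ^+ 2) <= N * (4 * m) by apply: ler_wpM2l => //; nra.
by move: m2; rewrite /K; lra.
Qed.

End ComponentRange.

(** * The range of the first coordinate *)

Section Roots.
Variable R : realType.

Lemma kappa_roots (a b x : R) : -2 < a < 2 -> -2 < b < 2 ->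
  kappa a b x = (x - Iminus a b) * (x - Iplus a b).
Proof.
move=> /andP[a1 a2] /andP[b1 b2].
have D0 : 0 <= (a ^+ 2 - 4) * (b ^+ 2 - 4).
  by rewrite -mulrNN !opprB mulr_ge0 //; nra.
have := sqr_sqrtr D0; rewrite /kappa /Iminus /Iplus.
by move: (Num.sqrt _) => s sE; lra.
Qed.

(** With [s] the square root in the endpoints, [(4 - a b)^2 - s^2 = 4 (a - b)^2] and
    [(4 + a b)^2 - s^2 = 4 (a + b)^2]. *)
Lemma interval_bounds (a b : R) : -2 < a < 2 -> -2 < b < 2 ->
  a != b -> a != - b ->
  [/\ -2 < Iminus a b, Iminus a b < Iplus a b & Iplus a b < 2].
Proof.
move=> /andP[a1 a2] /andP[b1 b2] ab aNb.
have D0 : 0 < (a ^+ 2 - 4) * (b ^+ 2 - 4).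
  by rewrite -mulrNN !opprB mulr_gt0 //; nra.
have := sqr_sqrtr (ltW D0).
have s0 : 0 < Num.sqrt ((a ^+ 2 - 4) * (b ^+ 2 - 4)) by rewrite sqrtr_gt0.
rewrite /Iminus /Iplus; move: (Num.sqrt _) s0 => s s0 sE.
have m0 : 0 < (a - b) ^+ 2 by rewrite exprn_even_gt0 // subr_eq0.
have p0 : 0 < (a + b) ^+ 2 by rewrite exprn_even_gt0 // addr_eq0.
have s1 : s < 4 - a * b.
  rewrite -(ltr_pXn2r (_ : (0 < 2)%N)) ?nnegrE ?ltW //; nra.
have s2 : s < 4 + a * b.
  rewrite -(ltr_pXn2r (_ : (0 < 2)%N)) ?nnegrE ?ltW //; nra.
by split; lra.
Qed.

Lemma le0_between (u p q : R) : p < q -> (u - p) * (u - q) <= 0 -> p <= u <= q.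
Proof. by move=> *; apply/andP; split; nra. Qed.

Lemma ge0_outside (u p q : R) :
  p < q -> 0 <= (u - p) * (u - q) -> u <= p \/ q <= u.
Proof.
move=> pq H; have [|up] := leP u p; first by left.
by have [|uq] := leP q u; [right|nra].
Qed.

Lemma gt0_outside (u p q : R) : p < q -> u < p \/ q < u ->
  0 < (u - p) * (u - q).
Proof. by move=> pq [?|?]; nra. Qed.

Lemma disjoint_ge0 (u p1 q1 p2 q2 : R) : p1 < q1 -> p2 < q2 ->
  q1 < p2 \/ q2 < p1 -> 0 <= (u - p1) * (u - q1) * ((u - p2) * (u - q2)) ->
  0 <= (u - p1) * (u - q1) /\ 0 <= (u - p2) * (u - q2).
Proof.
move=> pq1 pq2 dis.
have key (v w : R) : (v <= 0 -> w <= 0 -> False) -> 0 <= v * w -> 0 <= v /\ 0 <= w.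
  move=> H vw; have [v0|v0] := leP 0 v; have [w0|w0] := leP 0 w => //.
  - by case: H; [nra|lra].
  - by case: H; [lra|nra].
  - by case: H; lra.
apply: key => /(le0_between pq1)/andP[? ?] /(le0_between pq2)/andP[? ?].
by case: dis; lra.
Qed.

Lemma lt2_sqr (x : R) : `|x| < 2 -> 0 < 4 - x ^+ 2.
Proof. by rewrite -(real_normK (num_real x)); have := normr_ge0 x; nra. Qed.

(** The six cases are the possible orders of the endpoints. The middle interval from [r2] to [r3] is
    the overlap of the two intervals if they meet, and the gap between them if they are disjoint. *)
Lemma sorted_roots (p1 q1 p2 q2 : R) :
  [/\ -2 < p1, p1 < q1 & q1 < 2] -> [/\ -2 < p2, p2 < q2 & q2 < 2] ->
  p1 != p2 -> p1 != q2 -> q1 != p2 -> q1 != q2 ->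
  exists r1 r2 r3 r4 : R,
  [/\ [/\ -2 < r1, r1 < r2, r2 < r3, r3 < r4 & r4 < 2],
      forall x, (x - p1) * (x - q1) * ((x - p2) * (x - q2)) =
        (x - r1) * (x - r2) * (x - r3) * (x - r4),
      p1 <= q2 -> p2 <= q1 ->
        forall x, p1 <= x <= q1 -> p2 <= x <= q2 -> r2 <= x <= r3 &
      q1 < p2 \/ q2 < p1 -> forall x, x <= p1 \/ q1 <= x ->
        x <= p2 \/ q2 <= x -> x < q1 \/ x < q2 -> p1 < x \/ p2 < x ->
        r2 <= x <= r3].
Proof.
move=> [p1m p1q1 q1m] [p2m p2q2 q2m] n1 n2 n3 n4.
case: (ltgtP p1 p2) n1 => // l1 _; case: (ltgtP p1 q2) n2 => // l2 _;
case: (ltgtP q1 p2) n3 => // l3 _; case: (ltgtP q1 q2) n4 => // l4 _; try lra.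
- exists p1, q1, p2, q2; split; [by split|by move=> x; ring|lra|].
  by move=> _ x [?|?] [?|?] [?|?] [?|?]; lra.
- exists p1, p2, q1, q2; split; [by split|by move=> x; ring| |].
    by move=> _ _ x /andP[? ?] /andP[? ?]; lra.
  by move=> [?|?] x; lra.
- exists p1, p2, q2, q1; split; [by split|by move=> x; ring| |].
    by move=> _ _ x /andP[? ?] /andP[? ?]; lra.
  by move=> [?|?] x; lra.
- exists p2, p1, q1, q2; split; [by split|by move=> x; ring| |].
    by move=> _ _ x /andP[? ?] /andP[? ?]; lra.
  by move=> [?|?] x; lra.
- exists p2, p1, q2, q1; split; [by split|by move=> x; ring| |].
    by move=> _ _ x /andP[? ?] /andP[? ?]; lra.
  by move=> [?|?] x; lra.
- exists p2, q2, p1, q1; split; [by split|by move=> x; ring|lra|].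
  by move=> _ x [?|?] [?|?] [?|?] [?|?]; lra.
Qed.

End Roots.

(** * The moduli space lies over the two middle roots *)

Section ModuliRange.
Variable R : realType.
Variables a b c d : R.
Local Notation e1 := (a * b + c * d).
Local Notation e2 := (a * d + b * c).
Local Notation e3 := (a * c + b * d).
Local Notation h := (a ^+ 2 + b ^+ 2 + c ^+ 2 + d ^+ 2 + a * b * c * d - 4).

Hypotheses (a2 : -2 < a < 2) (b2 : -2 < b < 2) (c2 : -2 < c < 2) (d2 : -2 < d < 2).
Hypotheses (ab : a != b) (aNb : a != - b) (cd : c != d) (cNd : c != - d).
Hypothesis no_common_root : forall x, kappa a b x = 0 -> kappa c d x != 0.

Lemma moduli_SU2_surf x y z :
  moduli_SU2 (a, b, c, d) (x, y, z) -> surf e1 e2 e3 h x y z.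
Proof.
exact: (@moduli_surface _ (@SU2 R) (@SU2_det R) (@SU2_mul R) R (real_complex R)).
Qed.

Local Notation p1 := (Iminus a b).
Local Notation q1 := (Iplus a b).
Local Notation p2 := (Iminus c d).
Local Notation q2 := (Iplus c d).

(** Since |x| < 2, the level is nonnegative, which keeps [x] out of the interiors of both intervals.
    A position beyond both of them is excluded by [compact_component_side], with sign 1 on the right
    and -1 on the left. *)
Lemma disjoint_moduli_range x y z : moduli_SL2R (a, b, c, d) (x, y, z) ->
  compact (connected_component (moduli_SL2R (a, b, c, d)) (x, y, z)) ->
  q1 < p2 \/ q2 < p1 ->
  [/\ x <= p1 \/ q1 <= x, x <= p2 \/ q2 <= x, x < q1 \/ x < q2 & p1 < x \/ p2 < x].
Proof.
move=> Mp cp dis; have S := moduli_SL2R_surf Mp.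
have [p1m pq1 q1m] := interval_bounds a2 b2 ab aNb.
have [p2m pq2 q2m] := interval_bounds c2 d2 cd cNd.
have kab u := kappa_roots u a2 b2; have kcd u := kappa_roots u c2 d2.
have kpos t : 2 <= `|t| -> 0 < kappa a b t.
  move=> t2; rewrite kab; apply: gt0_outside => //.
  by move: t2; rewrite ler_normr => /orP[?|?]; [right|left]; lra.
have x2 := compact_component_lt2 a2 kpos Mp cp.
have lev0 : 0 <= (x - p1) * (x - q1) * ((x - p2) * (x - q2)).
  rewrite -kab -kcd -level_kappa.
  have D0 : 0 <= (4 - x ^+ 2) * disc e1 e2 e3 h x y.
    by rewrite mulr_ge0 ?(surf_disc_ge0 S) // ltW // lt2_sqr.
  rewrite -(pmulr_rge0 _ (ltr0n _ 4)); apply: le_trans D0 _.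
  by rewrite disc_level lerBlDr lerDl sqr_ge0.
have [k1 k2] := disjoint_ge0 pq1 pq2 dis lev0.
have k0 : 0 <= kappa a b x by rewrite kab.
have /ltr_normlP[x21 x22] := x2.
split; [exact: ge0_outside|exact: ge0_outside| |].
- have [|H1] := ltP x q1; first by left.
  have [|H2] := ltP x q2; first by right.
  have e23 : e2 != 1 * e3.
    rewrite mul1r -subr_eq0 (_ : _ - _ = (a - b) * (d - c)); last by ring.
    by rewrite mulf_neq0 // subr_eq0 // eq_sym.
  case: (compact_component_side a2 Mp cp (expr1n _ _) x2 e23 k0).
    by rewrite mul1r; lra.
  move=> t; rewrite !mul1r kab kcd => /andP[t1 t2].
  by split; [|apply: ltW]; apply: gt0_outside => //; right; lra.
- have [|H1] := ltP p1 x; first by left.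
  have [|H2] := ltP p2 x; first by right.
  have e23 : e2 != -1 * e3.
    rewrite -subr_eq0 (_ : _ - _ = (a + b) * (c + d)); last by ring.
    by rewrite mulf_neq0 // addr_eq0.
  have sg2 : (-1 : R) ^+ 2 = 1 by rewrite sqrrN expr1n.
  case: (compact_component_side a2 Mp cp sg2 x2 e23 k0).
    by rewrite mulN1r; lra.
  move=> t; rewrite !mulN1r kab kcd => /andP[t1 t2].
  by split; [|apply: ltW]; apply: gt0_outside => //; left; lra.
Qed.

(** An inclusion suffices here, because orbit closures will be shown to contain every point of the
    surface with [r2 <= x <= r3]. *)
Lemma MB_range : exists r1 r2 r3 r4 : R,
  [/\ [/\ -2 < r1, r1 < r2, r2 < r3, r3 < r4 & r4 < 2],
      forall x, level e1 e2 e3 h x = (x - r1) * (x - r2) * (x - r3) * (x - r4) &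
      forall x y z, MB (a, b, c, d) (x, y, z) ->
        surf e1 e2 e3 h x y z /\ r2 <= x <= r3].
Proof.
have H1 := interval_bounds a2 b2 ab aNb.
have H2 := interval_bounds c2 d2 cd cNd.
have [_ pq1 _] := H1; have [_ pq2 _] := H2.
have kab u := kappa_roots u a2 b2; have kcd u := kappa_roots u c2 d2.
have ne u : (u - p1) * (u - q1) = 0 -> u != p2 /\ u != q2.
  by rewrite -kab => /no_common_root; rewrite kcd mulf_eq0 negb_or !subr_eq0 => /andP[].
have [n1 n2] : p1 != p2 /\ p1 != q2 by apply: ne; rewrite subrr mul0r.
have [n3 n4] : q1 != p2 /\ q1 != q2 by apply: ne; rewrite subrr mulr0.
have [r1 [r2 [r3 [r4 [rs rE meet apart]]]]] := sorted_roots H1 H2 n1 n2 n3 n4.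
exists r1, r2, r3, r4; split=> // [x|x y z].
  by rewrite level_kappa kab kcd rE.
rewrite /MB; case: asboolP => [[t /= []]|nmeet].
  rewrite !in_itv /= => /andP[t1 t2] /andP[t3 t4] Mp; split.
    exact: moduli_SU2_surf.
  have [kx1 kx2] := moduli_SU2_kappa Mp; rewrite kab in kx1; rewrite kcd in kx2.
  apply: meet; [exact: le_trans t4|exact: le_trans t2|exact: le0_between|].
  exact: le0_between.
move=> [Mp cp]; split; first exact: moduli_SL2R_surf.
have dis : q1 < p2 \/ q2 < p1.
  have [|l1] := ltP q1 p2; first by left.
  have [|l2] := ltP q2 p1; first by right.
  case: nmeet; have [l3|l3] := leP p1 p2.
    by exists p2; split; rewrite /= in_itv /= ?lexx ?l3 ?l1 ?(ltW pq2).
  by exists p1; split; rewrite /= in_itv /= ?lexx ?l2 ?(ltW l3) ?(ltW pq1).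
by have [] := disjoint_moduli_range Mp cp dis; exact: apart.
Qed.

End ModuliRange.

(** * Sections of the surface as rotated circles *)

Section DenseTranslations.
Variable R : realType.

(** The periods of [A] form a group. If it has arbitrarily small positive elements, then [A] is
    dense, hence everything; otherwise it is cyclic, and [u] and [v] are commensurable. *)
Lemma closed_two_translations (A : set R) (u v : R) : closed A ->
  0 < u -> 0 < v -> (forall m n : nat, (0 < n)%N -> u *+ n != v *+ m) ->
  (forall s, A s <-> A (s + u)) -> (forall s, A s <-> A (s + v)) ->
  A !=set0 -> forall s, A s.
Proof.
move=> Acl u0 v0 uv Au Av [s0 As0] s.
pose G : set R := [set w | forall s, A s <-> A (s + w)].
have GB w w' : G w -> G w' -> G (w - w').
  move=> Gw Gw' t; rewrite addrA (Gw' (t + w - w')) subrK; exact: Gw.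
have GM w n : G w -> G (w *+ n).
  move=> Gw; elim: n => [|n IH t]; first by move=> t; rewrite mulr0n addr0.
  by rewrite mulrS addrA -(IH (t + w)); exact: Gw.
have small e : 0 < e -> exists2 g, G g & 0 < g < e.
  move=> e0; apply: contrapT => none.
  have big g : G g -> 0 < g -> e <= g.
    by move=> Gg g0; rewrite leNgt; apply/negP => ge; apply: none; exists g; rewrite ?g0.
  pose P := [set g | G g /\ 0 < g].
  have hP : has_inf P by split; [exists u|exists 0 => g [_ /ltW]].
  (* A period within [e] of the infimum already generates: a remainder [r] strictly between 0 and
     [g0] would give a period [g0 - r >= e], so that [r] would be below the infimum. *)
  have [g0 [Gg0 g00] g0I] := inf_adherent e0 hP.
  have mult g : G g -> 0 < g -> exists2 k, (0 < k)%N & g = g0 *+ k.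
    move=> Gg gp; pose k := Num.truncn (g / g0).
    have := truncn_itv (divr_ge0 (ltW gp) (ltW g00)); rewrite -/k => /andP[k1 k2].
    rewrite ler_pdivlMr // mulr_natl in k1.
    rewrite ltr_pdivrMr // mulr_natl mulrS in k2.
    have Gr : G (g - g0 *+ k) by apply: GB => //; exact: GM.
    have [r0|r0] := ltP 0 (g - g0 *+ k).
      have : inf P <= g - g0 *+ k by apply: ge_inf => //; exact: hP.2.
      have : e <= g0 - (g - g0 *+ k) by apply: big; [exact: GB|lra].
      lra.
    have gE : g = g0 *+ k by lra.
    exists k => //; rewrite lt0n; apply/eqP => k0.
    by rewrite k0 mulr0n in gE; lra.
  have [k kp uE] := mult u Au u0; have [l lp vE] := mult v Av v0.
  by have := uv k l lp; rewrite uE vE -!mulrnA mulnC eqxx.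
have dens : closure A s.
  move=> U /nbhs_ballP[e /= e0 eU]; have [g Gg /andP[g0 ge]] := small e e0.
  have hit (w : R) : 0 <= w -> exists k, `|w - g *+ k| < e.
    move=> w0; exists (Num.truncn (w / g)).
    have := truncn_itv (divr_ge0 w0 (ltW g0)).
    rewrite ler_pdivlMr // ltr_pdivrMr // !mulr_natl mulrS => /andP[k1 k2].
    by rewrite ger0_norm; lra.
  have [ss|ss] := leP s0 s.
    have [k kE] := hit (s - s0) (ltac:(by rewrite subr_ge0)).
    exists (s0 + g *+ k); split; first exact: (GM g k Gg s0).1.
    by apply: eU; rewrite /ball /= (_ : _ - _ = s - s0 - g *+ k) //; ring.
  have [k kE] := hit (s0 - s) (ltac:(by rewrite subr_ge0 ltW)).
  exists (s0 - g *+ k); split; first by apply: (GM g k Gg _).2; rewrite subrK.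
  by apply: eU; rewrite /ball /= distrC (_ : _ - _ = s0 - s - g *+ k) //; ring.
by move/closure_id: Acl => ->.
Qed.

Lemma angle_exists (c s : R) : c ^+ 2 + s ^+ 2 = 1 ->
  exists p, c = cos p /\ s = sin p.
Proof.
move=> E; have c1 : -1 <= c <= 1 by rewrite -ler_norml -(ler_pXn2r (_ : (0 < 2)%N)) ?nnegrE //
  real_normK ?num_real // expr1n; nra.
have ca : cos (acos c) = c by rewrite acosK // in_itv.
have sa : sin (acos c) = `|s|.
  by rewrite sin_acos // -E addrAC subrr add0r sqrtr_sqr.
have [s0|s0] := leP 0 s.
  by exists (acos c); rewrite ca sa ger0_norm.
by exists (- acos c); rewrite cosN sinN ca sa ltr0_norm // opprK.
Qed.

(** Since the cosine is even, natural numerators cover all rational multiples of pi; [n.+1] keeps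
    the denominator nonzero. *)
Definition rational_traces : set R :=
  [set x | exists m n : nat, x = 2 * cos (pi * m%:R / n.+1%:R)].

Lemma countable_rational_traces : countable rational_traces.
Proof.
apply: (@sub_countable _ _ _ (range (fun mn : nat * nat =>
  2 * cos (pi * mn.1%:R / mn.2.+1%:R) : R))).
  by apply: subset_card_le => x [m [n ->]]; exists (m, n).
by apply: sub_countable (card_image_le _ _) _; exact: countableP.
Qed.

End DenseTranslations.

(** * Trigonometric parametrization of the x-sections *)

Section SliceParametrization.
Variable R : realType.
Variables e1 e2 e3 h : R.
Local Notation sf := (surf e1 e2 e3 h).
Local Notation lv := (level e1 e2 e3 h).
Implicit Types (x y z c s : R).

(** [slice_y] and [slice_z] give the centre of the ellipse and [slice_r] its size; [half_sin x] is
    sin t when x = 2 cos t with 0 < t < pi. *)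
Definition slice_y x := (2 * e2 - x * e3) / (4 - x ^+ 2).
Definition slice_z x := (2 * e3 - x * e2) / (4 - x ^+ 2).
Definition slice_r x := 2 * Num.sqrt (lv x) / (4 - x ^+ 2).
Definition half_sin x := Num.sqrt (4 - x ^+ 2) / 2.

(* With x = 2 cos t, c = cos p and s = sin p, the point of the ellipse cut out
   of the surface at abscissa x with coordinates proportional to
   (cos p, - cos (p + t)) around the centre of the ellipse. *)
Definition slice_point x c s : R * R * R :=
  (x, slice_y x + slice_r x * c,
      slice_z x + slice_r x * (half_sin x * s - x / 2 * c)).

Lemma half_sin_sqr x : `|x| < 2 -> half_sin x ^+ 2 = (4 - x ^+ 2) / 4.
Proof.
move=> /lt2_sqr x4; rewrite /half_sin expr_div_n sqr_sqrtr; last exact: ltW.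
by congr (_ / _); ring.
Qed.

Lemma half_sin_gt0 x : `|x| < 2 -> 0 < half_sin x.
Proof. by move=> /lt2_sqr x4; rewrite divr_gt0 // sqrtr_gt0. Qed.

Lemma slice_r_sqr x : 0 <= lv x ->
  slice_r x ^+ 2 = 4 * lv x / (4 - x ^+ 2) ^+ 2.
Proof.
move=> l0; rewrite /slice_r expr_div_n exprMn sqr_sqrtr //.
by congr (_ / _); ring.
Qed.

Lemma surf_centered x y z : `|x| < 2 -> sf x y z <->
  (4 - x ^+ 2) * ((y - slice_y x) ^+ 2 + (z - slice_z x) ^+ 2
    + x * (y - slice_y x) * (z - slice_z x)) = lv x.
Proof.
move=> /lt2_sqr x4; have x0 : 4 - x ^+ 2 != 0 by rewrite gt_eqF.
have E : (4 - x ^+ 2) * ((y - slice_y x) ^+ 2 + (z - slice_z x) ^+ 2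
    + x * (y - slice_y x) * (z - slice_z x)) - lv x = (4 - x ^+ 2) *
    (x ^+ 2 + y ^+ 2 + z ^+ 2 + x * y * z - (e1 * x + e2 * y + e3 * z - h)).
  by rewrite /slice_y /slice_z /level; field.
rewrite /surf; split=> H.
  by apply/eqP; rewrite -subr_eq0 E H subrr mulr0.
by apply/eqP; rewrite -subr_eq0 -(mulrI_eq0 _ (mulfI x0)) -E H subrr.
Qed.

Lemma surf_slice_point x c s : `|x| < 2 -> 0 <= lv x ->
  c ^+ 2 + s ^+ 2 = 1 ->
  sf x (slice_point x c s).1.2 (slice_point x c s).2.
Proof.
move=> x2 l0 cs; apply/surf_centered => //=.
have x0 : 4 - x ^+ 2 != 0 by rewrite gt_eqF // lt2_sqr.
have hs := half_sin_sqr x2; have rs := slice_r_sqr l0.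
rewrite ![_ + _ - slice_y x]addrAC ![_ + _ - slice_z x]addrAC !subrr !add0r.
rewrite [X in _ * X](_ : _ = slice_r x ^+ 2 *
  ((1 - x ^+ 2 / 4) * c ^+ 2 + half_sin x ^+ 2 * s ^+ 2)); last by field.
rewrite hs rs (_ : (1 - x ^+ 2 / 4) = (4 - x ^+ 2) / 4); last by field.
by rewrite -mulrDr cs mulr1; field.
Qed.

Lemma slice_point_surj x y z : `|x| < 2 -> sf x y z ->
  exists p, (x, y, z) = slice_point x (cos p) (sin p).
Proof.
move=> x2 S; have x4 := lt2_sqr x2; have E := (surf_centered y z x2).1 S.
have x0 : 4 - x ^+ 2 != 0 by rewrite gt_eqF.
have hs := half_sin_sqr x2; have h0 := half_sin_gt0 x2.
have l0 : 0 <= lv x.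
  rewrite -E; apply: mulr_ge0; first exact: ltW.
  rewrite [X in 0 <= X](_ : _ = (y - slice_y x + x / 2 * (z - slice_z x)) ^+ 2
    + (4 - x ^+ 2) / 4 * (z - slice_z x) ^+ 2); last by field.
  by rewrite addr_ge0 ?sqr_ge0 // mulr_ge0 ?sqr_ge0 // divr_ge0 // ltW.
have rs := slice_r_sqr l0.
have rE : slice_r x ^+ 2 * ((4 - x ^+ 2) / 4) = (y - slice_y x) ^+ 2
    + (z - slice_z x) ^+ 2 + x * (y - slice_y x) * (z - slice_z x).
  by apply: (mulfI x0); rewrite E rs; field.
move: rE E; rewrite /slice_point.
set Y := y - _; set Z := z - _ => rE E.
(* At size 0 the section is a single point and any angle will do. *)
have [r0|r0] := eqVneq (slice_r x) 0.
  rewrite r0 expr0n /= mul0r in rE.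
  have sq : (Y + x / 2 * Z) ^+ 2 + (4 - x ^+ 2) / 4 * Z ^+ 2 = 0.
    by rewrite [RHS]rE; field.
  have Z0 : Z = 0.
    apply/eqP; rewrite -sqrf_eq0 eq_le sqr_ge0 andbT.
    rewrite -(pmulr_rle0 _ (_ : 0 < (4 - x ^+ 2) / 4)) ?divr_gt0 //.
    by have := sqr_ge0 (Y + x / 2 * Z); lra.
  have Y0 : Y = 0.
    by apply/eqP; rewrite -sqrf_eq0; apply/eqP; move: sq; rewrite Z0; lra.
  exists 0; rewrite r0 !mul0r !addr0; congr (_, _, _); rewrite -?/Y -?/Z.
    by move: Y0; rewrite /Y; lra.
  by move: Z0; rewrite /Z; lra.
pose c := Y / slice_r x; pose s := (Z / slice_r x + x / 2 * c) / half_sin x.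
have cE : slice_r x * c = Y by rewrite /c mulrC divfK.
have sE : slice_r x * (half_sin x * s) = Z + x / 2 * Y.
  have -> : half_sin x * s = Z / slice_r x + x / 2 * c.
    by rewrite /s mulrC divfK // gt_eqF.
  rewrite mulrDr [_ * (x / 2 * c)]mulrCA cE; congr (_ + _).
  by rewrite mulrC divfK.
have cs : c ^+ 2 + s ^+ 2 = 1.
  apply: (mulfI (_ : slice_r x ^+ 2 * ((4 - x ^+ 2) / 4) != 0)).
    by rewrite mulf_neq0 ?sqrf_eq0 // mulf_neq0 // invr_eq0 pnatr_eq0.
  rewrite mulr1 [RHS]rE mulrDr -{2}hs.
  rewrite (_ : _ * _ * s ^+ 2 = (slice_r x * (half_sin x * s)) ^+ 2); last by ring.
  rewrite (_ : _ * _ * c ^+ 2 = (4 - x ^+ 2) / 4 * (slice_r x * c) ^+ 2); last by ring.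
  by rewrite cE sE; field.
have [p [pc ps]] := angle_exists cs; exists p.
rewrite -pc -ps mulrBr sE [slice_r x * (x / 2 * c)]mulrCA cE /Y /Z; congr (_, _, _); ring.
Qed.

End SliceParametrization.

(** A countable set has Lebesgue measure zero, unlike a nonempty open interval. *)
Lemma countable_avoid (R : realType) (V : set R) (l r : R) :
  countable V -> l < r -> exists2 t, l < t < r & ~ V t.
Proof.
move=> Vc lr; apply: contrapT => H.
have sub : `]l, r[ `<=` V.
  move=> t; rewrite /= in_itv /= => tlr; apply: contrapT => nV.
  by apply: H; exists t.
have /countable_lebesgue_measure0 : countable (`]l, r[ : set R).
  by apply: sub_countable Vc; exact: subset_card_le.
rewrite lebesgue_measure_itv /= lte_fin lr -EFinB => -[] /eqP.
by rewrite subr_eq0 gt_eqF.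
Qed.

Lemma continuous_pos_nbhs (R : realType) (f : R -> R) (x : R) :
  {for x, continuous f} -> 0 < f x ->
  exists2 e, 0 < e & forall u, `|u - x| < e -> 0 < f u.
Proof.
move=> cf fx; have /cf : nbhs (f x) [set y | 0 < y].
  by apply: open_nbhs_nbhs; split=> //; exact: open_gt.
move=> /nbhs_ballP[e /= e0 H]; exists e => // u ue; apply: H.
by rewrite /ball /= distrC.
Qed.

(** * Closed invariant sets on an irrational section *)

Section TwistInvariance.
Variable R : realType.
Local Notation V := (@rational_traces R).
Implicit Types C : set (R * R * R).

(** Stability under the twist in X and its inverse. With [e1] in place of [e2] and [swapxy C] in
    place of [C], it expresses stability under the twists in Y, inverse first. *)
Definition invariantX (e2 e3 : R) C := forall x y z, C (x, y, z) ->
  C (x, e2 - x * (e3 - x * y - z) - y, e3 - x * y - z) /\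
  C (x, e2 - x * z - y, e3 - x * (e2 - x * z - y) - z).

Definition swapxy C : set (R * R * R) := [set p | C (p.1.2, p.1.1, p.2)].

Lemma closed_swapxy C : closed C -> closed (swapxy C).
Proof.
have cf p : {for p, continuous (fun p : R * R * R => (p.1.2, p.1.1, p.2))} by cts.
exact: (continuous_closedP _).1 cf C.
Qed.

(** With x = 2 cos t, the twist and its inverse translate the angle [u] by -2t and 2t. As x is not a
    rational trace, 2t and the period 2 pi are incommensurable, so [closed_two_translations]
    applies. *)
Lemma slice_closure e1 e2 e3 h C x y z y' z' : closed C ->
  invariantX e2 e3 C -> `|x| < 2 -> ~ V x ->
  surf e1 e2 e3 h x y z -> C (x, y, z) -> surf e1 e2 e3 h x y' z' -> C (x, y', z').
Proof.
move=> cC inv x2 nV S Cp S'.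
have x4 := lt2_sqr x2; have x0 : 4 - x ^+ 2 != 0 by rewrite gt_eqF.
have [p pE] := slice_point_surj x2 S; have [p' pE'] := slice_point_surj x2 S'.
pose P u := slice_point e1 e2 e3 h x (cos u) (sin u).
suff H : forall u, C (P u) by rewrite pE'; exact: H.
have /ltr_normlP[x21 x22] := x2.
pose t := acos (x / 2).
have ct : cos t = x / 2 by rewrite acosK // in_itv /=; lra.
have st : sin t = half_sin x.
  rewrite sin_acos; last by lra.
  rewrite /half_sin (_ : 4 - x ^+ 2 = 2 ^+ 2 * (1 - (x / 2) ^+ 2)); last by field.
  by rewrite sqrtrM ?sqr_ge0 // sqrtr_sqr ger0_norm // [RHS]mulrC mulKf.
have t0 : 0 < t by apply: acos_gt0; lra.
have tpi : t < pi by apply: acos_ltpi; lra.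
have tw2 : cos (t *+ 2) = x ^+ 2 / 2 - 1.
  by rewrite mulr2n cosD ct st -expr2 -expr2 half_sin_sqr //; field.
have tws : sin (t *+ 2) = x * half_sin x.
  by rewrite mulr2n sinD ct st; field.
(* At the centre the derivatives of the surface equation in y and z vanish. *)
have y0E : 2 * slice_y e2 e3 x + x * slice_z e2 e3 x = e2.
  by rewrite /slice_y /slice_z; field.
have z0E : 2 * slice_z e2 e3 x + x * slice_y e2 e3 x = e3.
  by rewrite /slice_y /slice_z; field.
have hs : half_sin x ^+ 2 = (4 - x ^+ 2) / 4 by exact: half_sin_sqr.
have step u : C (P u) -> C (P (u - t *+ 2)) /\ C (P (u + t *+ 2)).
  move=> /inv [C1 C2]; rewrite /P /slice_point cosB sinB cosD sinD tw2 tws.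
  move: (cos u) (sin u) (slice_r _ _ _ _ _) C1 C2 => c s r.
  move: (slice_y _ _ _) (slice_z _ _ _) y0E z0E => y0 z0 <- <- C1 C2.
  have [k kE] : exists k, k = half_sin x by exists (half_sin x).
  rewrite -kE in hs C1 C2 *; split.
  - congr (C _): C1; congr (_, _, _); first by field.
    apply/eqP; rewrite -subr_eq0.
    rewrite (_ : _ - _ = r * c * x * (k ^+ 2 - (4 - x ^+ 2) / 4)); last by field.
    by rewrite hs subrr mulr0.
  - congr (C _): C2; congr (_, _, _); first by field.
    apply/eqP; rewrite -subr_eq0.
    rewrite (_ : _ - _ = - r * c * x * (k ^+ 2 - (4 - x ^+ 2) / 4)); last by field.
    by rewrite hs subrr mulr0.
apply: (@closed_two_translations _ [set u | C (P u)] (t *+ 2) (pi *+ 2)).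
- have cP u : {for u, continuous P} by rewrite /P /slice_point; cts.
  exact: (continuous_closedP _).1 cP C cC.
- by rewrite mulrn_wgt0.
- by rewrite mulrn_wgt0 // pi_gt0.
- move=> m n n0; apply/eqP => E; apply: nV; exists m, n.-1.
  rewrite prednK // (_ : pi * _ / _ = t); last first.
    rewrite -(mulr_natr (t *+ 2)) -(mulr_natr (pi *+ 2)) -(mulr_natr t) -(mulr_natr pi) in E.
    have n0' : n%:R != 0 :> R by rewrite pnatr_eq0 -lt0n.
    by apply: (mulIf n0'); rewrite divfK //; lra.
  by rewrite ct mulrC divfK.
- move=> s; split=> [/step[]//|/step[+ _]]; by rewrite addrK.
- by move=> s; rewrite /= /P cosD2pi sinD2pi.
- by exists p; rewrite /= /P -pE.
Qed.

End TwistInvariance.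

(** * Closed invariant sets *)

Section Dynamics.
Variable R : realType.
Local Notation V := (@rational_traces R).
Variables e1 e2 e3 h : R.
Local Notation sf := (surf e1 e2 e3 h).
Local Notation D := (disc e1 e2 e3 h).

Lemma surf_swap x y z : surf e2 e1 e3 h y x z <-> sf x y z.
Proof. by rewrite /surf; split=> H; lra. Qed.

Lemma disc_swap x y : disc e2 e1 e3 h y x = D x y.
Proof. by rewrite /disc; ring. Qed.

(** On the surface the discriminant is the square of the derivative of the equation in z. *)
Lemma disc_partial_z x y z : sf x y z -> D x y = (2 * z + x * y - e3) ^+ 2.
Proof. by move=> /surf_disc ->; ring. Qed.

Variables r1 r2 r3 r4 : R.
Hypothesis roots : [/\ -2 < r1, r1 < r2, r2 < r3, r3 < r4 & r4 < 2].
Hypothesis level_roots : forall x,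
  level e1 e2 e3 h x = (x - r1) * (x - r2) * (x - r3) * (x - r4).

Lemma range_lt2 x : r2 <= x <= r3 -> `|x| < 2.
Proof. by case: roots => *; rewrite ltr_norml; lra. Qed.

Lemma level_ge0 x : r2 <= x <= r3 -> 0 <= level e1 e2 e3 h x.
Proof.
case: roots => ? ? ? ? ? /andP[? ?]; rewrite level_roots -mulrA.
by apply: mulr_ge0; [apply: mulr_ge0|apply: mulr_le0]; lra.
Qed.

Lemma level_gt0 x : r2 < x < r3 -> 0 < level e1 e2 e3 h x.
Proof.
case: roots => ? ? ? ? ? /andP[? ?]; rewrite level_roots -mulrA.
by apply: mulr_gt0; [apply: mulr_gt0|rewrite nmulr_lgt0]; lra.
Qed.

(* When |y| >= 2, the discriminant is convex in x, but it is negative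
   immediately to the left of r2 and to the right of r3. *)
Lemma range_y_lt2 x y z : sf x y z -> r2 <= x <= r3 -> `|y| < 2.
Proof.
move=> S xr; have [R1 R2 R3 R4 R5] := roots; rewrite ltNge; apply/negP => y2.
have y4 : 0 <= y ^+ 2 - 4.
  by rewrite -(real_normK (num_real y)); nra.
have neg u : `|u| < 2 -> level e1 e2 e3 h u < 0 -> D u y < 0.
  move=> /lt2_sqr u4 lu; rewrite -(pmulr_rlt0 _ u4) disc_level.
  have := sqr_ge0 ((4 - u ^+ 2) * y - (2 * e2 - u * e3)).
  by move=> ?; lra.
(* Points on either side of [[r2, r3]] at which the quartic is negative. *)
pose u := (r1 + r2) / 2; pose v := (r3 + r4) / 2.
have Du : D u y < 0.
  apply: neg; first by rewrite ltr_norml /u; lra.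
  rewrite level_roots -mulrA nmulr_rlt0.
    by rewrite nmulr_rgt0 /u; lra.
  by rewrite pmulr_rlt0 /u; lra.
have Dv : D v y < 0.
  apply: neg; first by rewrite ltr_norml /v; lra.
  by rewrite level_roots pmulr_rlt0 /v ?mulr_gt0 //; lra.
have Dx := surf_disc_ge0 S.
have xu : 0 < x - u by rewrite /u; lra.
have vx : 0 < v - x by rewrite /v; lra.
have : 0 <= (v - u) * D x y by apply: mulr_ge0 => //; lra.
rewrite (_ : _ * D x y = (v - x) * D u y + (x - u) * D v y
    - (y ^+ 2 - 4) * ((x - u) * (v - x) * (v - u))); last by rewrite /disc; ring.
have : (v - x) * D u y < 0 by rewrite pmulr_rlt0.
have : (x - u) * D v y < 0 by rewrite pmulr_rlt0.
have : 0 <= (y ^+ 2 - 4) * ((x - u) * (v - x) * (v - u)).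
  by apply: mulr_ge0 => //; do 2?apply: mulr_ge0; lra.
by move: (_ * D u y) (_ * D v y) (_ * (_ * _)) => A B C; lra.
Qed.

(** On the surface, [disc_level] writes [4 * level] as a sum of two squares with positive weights,
    whose common vanishing is that of the derivatives in y and z. *)
Lemma level0_critical x y z : `|x| < 2 -> sf x y z ->
  level e1 e2 e3 h x = 0 <->
  2 * y + x * z = e2 /\ 2 * z + x * y = e3.
Proof.
move=> /lt2_sqr x4 S; have := disc_level e1 e2 e3 h x y.
rewrite (disc_partial_z S) => E; split=> [l0|[h2 h3]].
  rewrite l0 mulr0 sub0r in E.
  have s1 := sqr_ge0 ((4 - x ^+ 2) * y - (2 * e2 - x * e3)).
  have s2 : 0 <= (4 - x ^+ 2) * (2 * z + x * y - e3) ^+ 2.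
    by apply: mulr_ge0; [exact: ltW|exact: sqr_ge0].
  have /eqP : (4 - x ^+ 2) * (2 * z + x * y - e3) ^+ 2 = 0 by lra.
  have /eqP : ((4 - x ^+ 2) * y - (2 * e2 - x * e3)) ^+ 2 = 0 by lra.
  rewrite sqrf_eq0 => /eqP E1; rewrite mulf_eq0 (gt_eqF x4) /= sqrf_eq0 => /eqP E2.
  have e3E : e3 = 2 * z + x * y by lra.
  by split; [rewrite e3E in E1; lra|].
have E1 : (4 - x ^+ 2) * y - (2 * e2 - x * e3) = 0 by rewrite -h2 -h3; ring.
have E2 : 2 * z + x * y - e3 = 0 by lra.
by move: E; rewrite E1 E2 expr0n /= mulr0 subr0 => E; lra.
Qed.

Lemma level_roots0 x : r2 <= x <= r3 ->
  level e1 e2 e3 h x = 0 -> x = r2 \/ x = r3.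
Proof.
move=> xr; have [R1 R2 R3 R4 R5] := roots; rewrite level_roots => /eqP.
rewrite !mulf_eq0 -!orbA !subr_eq0 => /or4P[] /eqP xE; [lra|by left|by right|lra].
Qed.

(* At a singular point of the surface, the level would have a double root. *)
Lemma range_smooth x y z : sf x y z -> r2 <= x <= r3 ->
  2 * x + y * z = e1 -> 2 * y + x * z = e2 -> 2 * z + x * y = e3 -> False.
Proof.
move=> S xr h1 h2 h3.
have l0 : level e1 e2 e3 h x = 0.
  by apply/(level0_critical (range_lt2 xr) S).
(* [K / 4] is the quotient of the level by the square of [t - x]. *)
pose K t := (4 - t ^+ 2) * (y ^+ 2 - 4) + (e3 - (t + x) * y) ^+ 2.
have lK t : 4 * level e1 e2 e3 h t = (t - x) ^+ 2 * K t.
  have S' := S; rewrite /surf in S'.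
  have hE : h = e1 * x + e2 * y + e3 * z - (x ^+ 2 + y ^+ 2 + z ^+ 2 + x * y * z).
    by lra.
  by rewrite /level /K hE -h1 -h2 -h3; field.
have cubic_root s1 s2 s3 : x != s1 -> x != s2 -> x != s3 ->
    (forall t, 4 * ((t - x) * (t - s1) * (t - s2) * (t - s3)) =
       (t - x) ^+ 2 * K t) -> False.
  move=> n1 n2 n3 H.
  pose P t := 4 * ((t - s1) * (t - s2) * (t - s3)) - (t - x) * K t.
  have P0 t : t != 0 -> P (x + t) = 0.
    move=> t0; apply: (mulfI t0); rewrite mulr0 /P.
    have := H (x + t); rewrite (_ : x + t - x = t); last by ring.
    by move=> {}H; lra.
  (* Cancelling [t - x] is legitimate only for [t != x]. The value of the cubic polynomial [P] at
     [x] is recovered from its vanishing fourth difference. *)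
  have : 6 * P x = 0.
    rewrite (_ : 6 * P x = 4 * P (x + 1) + 4 * P (x + -1) - P (x + 2) - P (x + -2)).
      by rewrite !P0 ?oppr_eq0 ?oner_eq0 ?pnatr_eq0 //; ring.
    by rewrite /P /K; ring.
  rewrite /P subrr mul0r subr0 => /eqP.
  by rewrite !mulf_eq0 !subr_eq0 !pnatr_eq0 (negPf n1) (negPf n2) (negPf n3).
have [R1 R2 R3 R4 R5] := roots.
have [xE|xE] := level_roots0 xr l0.
  apply: (cubic_root r1 r3 r4); rewrite ?xE; [lra|lra|lra|].
  by move=> t; rewrite -xE -lK level_roots xE; ring.
apply: (cubic_root r1 r2 r4); rewrite ?xE; [lra|lra|lra|].
by move=> t; rewrite -xE -lK level_roots xE; ring.
Qed.

Variable C : set (R * R * R).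
Hypothesis closedC : closed C.
Hypothesis C_range : forall x y z, C (x, y, z) -> sf x y z /\ r2 <= x <= r3.
Hypothesis C_X : invariantX e2 e3 C.
Hypothesis C_Y : invariantX e1 e3 (swapxy C).

Definition full x := forall y z, sf x y z -> C (x, y, z).

Lemma C_slice x y z y' z' : ~ V x -> C (x, y, z) -> sf x y' z' -> C (x, y', z').
Proof.
move=> nV Cp; have [S xr] := C_range Cp.
exact: (slice_closure closedC C_X (range_lt2 xr) nV S Cp).
Qed.

Lemma C_slice_y x y z x' z' : ~ V y -> C (x, y, z) -> sf x' y z' -> C (x', y, z').
Proof.
move=> nV Cp S'; have [S xr] := C_range Cp.
apply: (slice_closure (C := swapxy C) (x := y) (h := h) (e1 := e2) (y := x)
  (z := z) (closed_swapxy closedC) C_Y (range_y_lt2 S xr) nV).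
- exact/surf_swap.
- exact: Cp.
- exact/surf_swap.
Qed.

(** [slice_point] at a fixed angle is continuous in [x], so a point of the limit section is a limit
    of points of full sections. *)
Lemma full_limit x : r2 <= x <= r3 ->
  (forall e, 0 < e -> exists u, [/\ `|u - x| < e, r2 <= u <= r3 & full u]) ->
  full x.
Proof.
move=> xr H y z S; have x2 := range_lt2 xr.
have [p pE] := slice_point_surj x2 S; rewrite pE.
pose f u := slice_point e1 e2 e3 h u (cos p) (sin p).
have cf : {for x, continuous f}.
  have x4 := lt2_sqr x2.
  rewrite /f /slice_point /slice_y /slice_z /slice_r /half_sin /level.
  by cts; rewrite ?gt_eqF.
suff : closure C (f x) by move/closure_id: closedC => <-.
move=> U /cf /nbhs_ballP[e /= e0 eU].
have [u [ue ur fu]] := H e e0.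
exists (f u); split; last by apply: eU; rewrite /ball /= distrC.
have u2 := range_lt2 ur.
have := surf_slice_point u2 (level_ge0 ur) (cos2Dsin2 p).
by move/fu; rewrite /f /slice_point.
Qed.

(** A horizontal line at an irrational [y] near the centre meets the section where the discriminant
    is positive, so its y-section, contained in [C], reaches all nearby abscissae. The irrational
    ones among them are full, and the others are limits of these. *)
Lemma full_open x : r2 < x < r3 -> full x ->
  exists2 e, 0 < e & forall u, `|u - x| < e -> r2 < u < r3 -> full u.
Proof.
move=> xr fx; have xr' : r2 <= x <= r3 by move: xr => /andP[? ?]; lra.
have x2 := range_lt2 xr'; have x4 := lt2_sqr x2.
have Dy0 : 0 < D x (slice_y e2 e3 x).
  rewrite -(pmulr_rgt0 _ x4) disc_level.
  rewrite (_ : (4 - x ^+ 2) * slice_y e2 e3 x = 2 * e2 - x * e3); last first.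
    by rewrite /slice_y mulrC divfK // gt_eqF.
  by rewrite subrr expr0n subr0 mulr_gt0 // level_gt0.
have cD u : {for u, continuous (D x)} by rewrite /disc; cts.
have [e e0 eD] := continuous_pos_nbhs (cD _) Dy0.
have lt_e : slice_y e2 e3 x < slice_y e2 e3 x + e by rewrite ltrDl.
have [y /andP[y1 y2] nVy] := countable_avoid (@countable_rational_traces R) lt_e.
have Dy : 0 < D x y by apply: eD; rewrite ger0_norm; lra.
have cD' u : {for u, continuous (fun t => D t y)} by rewrite /disc; cts.
have [e' e'0 eD'] := continuous_pos_nbhs (cD' _) Dy.
have root u : 0 <= D u y -> exists z, sf u y z.
  by move=> Du; eexists; apply: (disc_surf (expr1n _ 2) Du).
have [z /fx Cz] := root x (ltW Dy).
have fullV u : `|u - x| < e' -> r2 < u < r3 -> ~ V u -> full u.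
  move=> /eD' /ltW /root[w Sw] ur nVu v v' Sv.
  exact: (C_slice nVu (C_slice_y nVy Cz Sw) Sv).
exists e' => // u ue /andP[u1 u2].
apply: full_limit => [|d d0]; first by rewrite !ltW.
have /ltr_normlP[ue1 ue2] := ue.
pose r := Num.min (Num.min (u + d) (x + e')) r3.
have ur : u < r by rewrite /r !lt_min u2 ltrDl d0 /=; lra.
have [t /andP[t1 t2] nVt] := countable_avoid (@countable_rational_traces R) ur.
move: t2; rewrite /r !lt_min => /andP[/andP[t2 t3] t4].
exists t; split; first by rewrite ger0_norm; lra.
  by lra.
apply: fullV => //; first by rewrite ltr_norml; lra.
by lra.
Qed.

(** The abscissae of full sections form a nonempty open and closed part of the connected interval
    [r2 < x < r3]; the two degenerate end sections follow as limits. *)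
Lemma full_everywhere x0 : r2 < x0 < r3 -> full x0 ->
  forall x y z, sf x y z -> r2 <= x <= r3 -> C (x, y, z).
Proof.
move=> x0r fx0.
pose A : set R := [set x | r2 < x < r3]; pose B := [set x | A x /\ full x].
have Aconn : connected A.
  apply/connected_intervalP => u v /= /andP[u1 u2] /andP[v1 v2] w /andP[uw wv].
  by rewrite /A /=; lra.
have BA : B = A.
  apply: Aconn; first by exists x0.
    exists [set t | exists2 e, 0 < e & forall u, `|u - t| < e -> A u -> full u].
      rewrite openE => t [e e0 H]; apply/nbhs_ballP; exists (e / 2) => /=.
        by rewrite divr_gt0.
      move=> s; rewrite /ball /= => ts; exists (e / 2); first by rewrite divr_gt0.
      move=> u us; apply: H.
      rewrite (_ : u - t = (u - s) - (t - s)); last by ring.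
      by apply: le_lt_trans (ler_normB _ _) _; lra.
    apply/seteqP; split=> t [At].
      by move=> ft; split=> //; apply: full_open.
    by move=> [e e0 H]; split=> //; apply: H => //; rewrite subrr normr0.
  exists (closure B); first exact: closed_closure.
  apply/seteqP; split=> t.
    by move=> Bt; split; [case: Bt|exact: subset_closure].
  move=> [At clt]; split=> //; apply: full_limit; first by move: At; rewrite /A /=; lra.
  move=> e e0; have /clt[u [[Au fu] ue]] : nbhs t (ball t e) by exact: nbhsx_ballx.
  exists u; split=> //; first by rewrite distrC.
  by move: Au; rewrite /A /=; lra.
move=> x y z S xr; apply: full_limit S => // e e0.
have [R1 R2 R3 R4 R5] := roots.
have lt1 : Num.max r2 (x - e) < Num.min r3 (x + e).
  by rewrite lt_min !gt_max; lra.
have [t /andP[]] := countable_avoid (@countable_rational_traces R) lt1.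
rewrite lt_min gt_max => /andP[t1 t2] /andP[t3 t4] _.
exists t; split; [by rewrite ltr_norml; lra|by lra|].
suff : B t by case.
by rewrite BA /A /=; lra.
Qed.

Hypothesis generic_sum : forall x y y' y'', V x -> V y -> V y' -> V y'' ->
  2 * e2 - x * e3 <> 2 * y + y' + y'' - x ^+ 2 * y.
Hypothesis generic_e1 : forall x, V x -> e1 <> 2 * x.
Hypothesis generic_e2 : forall y, V y -> e2 <> 2 * y.
Hypothesis generic_X : forall x y, V x -> V y ->
  let m := 2 - y ^+ 2 in let n := e3 - y * e1 + y * x in
  2 * y * m ^+ 2 + (e1 - x) * m * n - y * n ^+ 2 <> e2 * m ^+ 2.
Hypothesis generic_Y : forall x y, V x -> V y ->
  let m := 2 - x ^+ 2 in let n := e3 - x * e2 + x * y in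
  2 * x * m ^+ 2 + (e2 - y) * m * n - x * n ^+ 2 <> e1 * m ^+ 2.

(** * Absence of a full section contradicts genericity *)

Section NoFullSlice.
Hypothesis none : forall x, r2 < x < r3 -> ~ full x.

(** The section of an irrational [x] is full, so [x] must be [r2] or [r3], where the level
    vanishes. *)
Lemma irrational_x_critical x y z : C (x, y, z) -> ~ V x ->
  2 * y + x * z = e2 /\ 2 * z + x * y = e3.
Proof.
move=> Cp nV; have [S xr] := C_range Cp.
apply/(level0_critical (range_lt2 xr) S); rewrite level_roots.
have [xE|xn2] := eqVneq x r2; first by rewrite xE subrr; ring.
have [xE|xn3] := eqVneq x r3; first by rewrite xE subrr; ring.
case: (none (x := x)); last by move=> v w; exact: C_slice nV Cp.
by move: xr; rewrite !le_eqVlt eq_sym (negPf xn2) (negPf xn3).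
Qed.

(** The whole y-section lies in [C]. Were the derivative in z or in x nonzero, that section would
    cover an interval of abscissae, and an irrational one among them would be full. *)
Lemma irrational_y_critical x y z : C (x, y, z) -> ~ V y ->
  2 * x + y * z = e1 /\ 2 * z + x * y = e3.
Proof.
move=> Cp nV; have [S xr] := C_range Cp; have y2 := range_y_lt2 S xr.
have no_disc u : r2 < u < r3 -> ~ V u -> 0 <= D u y -> False.
  move=> ur nVu Du; apply: (none ur) => v w Sv.
  apply: (C_slice nVu _ Sv); apply: (C_slice_y nV Cp).
  exact: (disc_surf (expr1n _ 2) Du).
have fz : 2 * z + x * y = e3.
  apply/eqP; rewrite -subr_eq0; apply: contraT => fz; exfalso.
  have Dx : 0 < D x y by rewrite (disc_partial_z S) exprn_even_gt0.
  have cD u : {for u, continuous (fun t => D t y)} by rewrite /disc; cts.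
  have [e e0 eD] := continuous_pos_nbhs (cD _) Dx.
  have [R1 R2 R3 R4 R5] := roots.
  have lt1 : Num.max r2 (x - e) < Num.min r3 (x + e).
    by rewrite lt_min !gt_max; lra.
  have [t /andP[]] := countable_avoid (@countable_rational_traces R) lt1.
  rewrite lt_min gt_max => /andP[t1 t2] /andP[t3 t4] nVt.
  apply: (no_disc t) => //; first by rewrite t1.
  by apply/ltW/eD; rewrite ltr_norml; lra.
split=> //; apply/eqP; rewrite -subr_eq0; apply: contraT => fx; exfalso.
(* The second point of the surface on the line with these [y] and [z]; it differs from the first
   because the derivative in x is nonzero. *)
pose x' := e1 - y * z - x.
have S' : sf x' y z by move: S; rewrite /surf /x' => S; lra.
have [_ xr'] := C_range (C_slice_y nV Cp S').
have Dxx' u : (x <= u <= x') || (x' <= u <= x) -> 0 <= D u y.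
  have := disc_interval (e1 := e2) (e2 := e1) (e3 := e3) (h := h) y2.
  move=> I /orP[] ur; rewrite -disc_swap; move: ur; apply: I;
    by rewrite /= disc_swap ?(surf_disc_ge0 S) ?(surf_disc_ge0 S').
have xx' : x != x' by apply: contra fx => /eqP; rewrite /x' => H; apply/eqP; lra.
have [lt|lt] : x < x' \/ x' < x by move: xx'; rewrite neq_lt => /orP[]; [left|right].
  have [t /andP[t1 t2] nVt] := countable_avoid (@countable_rational_traces R) lt.
  by apply: (no_disc t) => //; [lra|apply: Dxx'; rewrite (ltW t1) (ltW t2)].
have [t /andP[t1 t2] nVt] := countable_avoid (@countable_rational_traces R) lt.
by apply: (no_disc t) => //; [lra|apply: Dxx'; rewrite (ltW t1) (ltW t2) orbT].
Qed.

(** By smoothness [y] is rational. A twist then leads to [x'], which is irrational by [generic_X];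
    comparing the two critical equations leaves [z = 0], against [generic_e2], or [x = x'], against
    smoothness. *)
Lemma irrational_x_absurd x y z : C (x, y, z) -> ~ V x -> False.
Proof.
move=> Cp nVx; have [S xr] := C_range Cp.
have [h2 h3] := irrational_x_critical Cp nVx.
have [Vy|nVy] := pselect (V y); last first.
  have [h1 _] := irrational_y_critical Cp nVy.
  exact: (range_smooth S xr h1 h2 h3).
pose x' := e1 - y * z - x.
(* By [h3] the reflection [z -> e3 - x * y - z] fixes [z], so the inverse twist in Y changes only
   [x]. *)
have Cp' : C (x', y, z).
  have [C1 _] := C_Y Cp; move: C1.
  by rewrite (_ : e3 - y * x - z = z) //; lra.
have [Vx'|nVx'] := pselect (V x').
  (* Eliminating [x] from [h3] gives [m * z = n]; then [h2] multiplied by [m ^+ 2] is the excluded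
     relation. *)
  apply: (generic_X Vx' Vy); rewrite /= -h2 -h3 (_ : e1 = x' + x + y * z).
    by ring.
  by rewrite /x'; ring.
have [h2' _] := irrational_x_critical Cp' nVx'.
have /eqP : (x - x') * z = 0 by lra.
rewrite mulf_eq0 => /orP[/eqP xx'|/eqP z0].
  by apply: (range_smooth S xr _ h2 h3); rewrite /x' in xx'; lra.
by apply: (generic_e2 Vy); rewrite -h2 z0; ring.
Qed.

Lemma irrational_y_absurd x y z : C (x, y, z) -> ~ V y -> False.
Proof.
move=> Cp nVy; have [S xr] := C_range Cp.
have [h1 h3] := irrational_y_critical Cp nVy.
have [Vx|nVx] := pselect (V x); last exact: irrational_x_absurd Cp nVx.
pose y' := e2 - x * z - y.
have Cp' : C (x, y', z).
  have [C1 _] := C_X Cp; move: C1.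
  by rewrite (_ : e3 - x * y - z = z) //; lra.
have [Vy'|nVy'] := pselect (V y').
  apply: (generic_Y Vx Vy'); rewrite /= -h1 -h3 (_ : e2 = y' + y + x * z).
    by ring.
  by rewrite /y'; ring.
have [h1' _] := irrational_y_critical Cp' nVy'.
have /eqP : (y - y') * z = 0 by lra.
rewrite mulf_eq0 => /orP[/eqP yy'|/eqP z0].
  by apply: (range_smooth S xr h1 _ h3); rewrite /y' in yy'; lra.
by apply: (generic_e1 Vx); rewrite -h1 z0; ring.
Qed.

Lemma no_full_slice_empty p : ~ C p.
Proof.
case: p => -[x y] z Cp.
have [Vx|nVx] := pselect (V x); last exact: irrational_x_absurd Cp nVx.
have [C1 C2] := C_X Cp.
have [Vy|nVy] := pselect (V y); last exact: irrational_y_absurd Cp nVy.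
have [Vy1|nVy1] := pselect (V (e2 - x * (e3 - x * y - z) - y));
  last exact: irrational_y_absurd C1 nVy1.
have [Vy2|nVy2] := pselect (V (e2 - x * z - y));
  last exact: irrational_y_absurd C2 nVy2.
(* The sum of the ordinates reached by the twist and by its inverse does not involve [z]. *)
by apply: (generic_sum Vx Vy Vy1 Vy2); ring.
Qed.

End NoFullSlice.

Theorem closed_invariant_full p : C p ->
  forall x y z, sf x y z -> r2 <= x <= r3 -> C (x, y, z).
Proof.
move=> Cp.
have [[x0 x0r fx0]|none] := pselect (exists2 x, r2 < x < r3 & full x).
  exact: full_everywhere fx0.
case: (@no_full_slice_empty _ p) => // x xr fx.
by apply: none; exists x.
Qed.

End Dynamics.

(** * Minimality for generic boundary data *)

Section Homeomorphism.
Variables (T : topologicalType) (M : set T) (f g : T -> T).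
Hypotheses (cf : continuous f) (cg : continuous g).
Hypotheses (fK : cancel f g) (gK : cancel g f).
Hypotheses (fM : forall p, M p -> M (f p)) (gM : forall p, M p -> M (g p)).

Lemma connected_component_homeo p : M p ->
  connected_component M (f p) = f @` connected_component M p.
Proof.
move=> Mp.
have key (k : T -> T) q : continuous k -> (forall r, M r -> M (k r)) -> M q ->
    k @` connected_component M q `<=` connected_component M (k q).
  move=> ck kM Mq; apply: connected_component_max.
  - by exists q => //; exact: connected_component_refl.
  - by move=> _ [r /connected_component_sub Mr <-]; exact: kM.
  - apply: connected_continuous_connected; first exact: component_connected.
    exact: continuous_subspaceT.
apply/seteqP; split; last exact: key.
move=> q qf; exists (g q); last exact: gK.
have := key g (f p) cg gM (fM Mp); rewrite fK; apply.
by exists q.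
Qed.

Lemma compact_component_homeo p : M p ->
  compact (connected_component M p) -> compact (connected_component M (f p)).
Proof.
move=> Mp cp; rewrite connected_component_homeo //.
by apply: continuous_compact => //; exact: continuous_subspaceT.
Qed.

Lemma closure_invariant (O : set T) p :
  (forall q, O q -> O (f q)) -> closure O p -> closure O (f p).
Proof.
move=> OO clp U /cf /clp[q [Oq Uq]]; exists (f q); split=> //; exact: OO.
Qed.

End Homeomorphism.

(** * The mapping class group acting on the moduli space *)

Section GammaAction.
Variable R : realType.
Local Notation space := (R * R * R)%type.
Variables a b c d : R.
Local Notation B := (a, b, c, d).
Local Notation e1 := (a * b + c * d).
Local Notation e2 := (a * d + b * c).
Local Notation e3 := (a * c + b * d).
Local Notation h := (a ^+ 2 + b ^+ 2 + c ^+ 2 + d ^+ 2 + a * b * c * d - 4).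

Lemma tauX_continuous : continuous (tauX B).
Proof.
have H (p : space) : {for p, continuous (fun p : space => (p.1.1,
  e2 - p.1.1 * (e3 - p.1.1 * p.1.2 - p.2) - p.1.2,
  e3 - p.1.1 * p.1.2 - p.2))} by cts.
rewrite (_ : tauX B = (fun p : space => (p.1.1,
  e2 - p.1.1 * (e3 - p.1.1 * p.1.2 - p.2) - p.1.2,
  e3 - p.1.1 * p.1.2 - p.2))); first exact: H.
by apply/funext => -[[x y] z].
Qed.

Lemma untauX_continuous : continuous (untauX B).
Proof.
have H (p : space) : {for p, continuous (fun p : space => (p.1.1,
  e2 - p.1.1 * p.2 - p.1.2,
  e3 - p.1.1 * (e2 - p.1.1 * p.2 - p.1.2) - p.2))} by cts.
rewrite (_ : untauX B = (fun p : space => (p.1.1,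
  e2 - p.1.1 * p.2 - p.1.2,
  e3 - p.1.1 * (e2 - p.1.1 * p.2 - p.1.2) - p.2))); first exact: H.
by apply/funext => -[[x y] z].
Qed.

Lemma tauY_continuous : continuous (tauY B).
Proof.
have H (p : space) : {for p, continuous (fun p : space => (
  e1 - p.1.2 * p.2 - p.1.1, p.1.2,
  e3 - p.1.2 * (e1 - p.1.2 * p.2 - p.1.1) - p.2))} by cts.
rewrite (_ : tauY B = (fun p : space => (
  e1 - p.1.2 * p.2 - p.1.1, p.1.2,
  e3 - p.1.2 * (e1 - p.1.2 * p.2 - p.1.1) - p.2))); first exact: H.
by apply/funext => -[[x y] z].
Qed.

Lemma untauY_continuous : continuous (untauY B).
Proof.
have H (p : space) : {for p, continuous (fun p : space => (
  e1 - p.1.2 * (e3 - p.1.1 * p.1.2 - p.2) - p.1.1, p.1.2,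
  e3 - p.1.1 * p.1.2 - p.2))} by cts.
rewrite (_ : untauY B = (fun p : space => (
  e1 - p.1.2 * (e3 - p.1.1 * p.1.2 - p.2) - p.1.1, p.1.2,
  e3 - p.1.1 * p.1.2 - p.2))); first exact: H.
by apply/funext => -[[x y] z].
Qed.

Lemma moduli_SL2R_maps p : moduli_SL2R B p ->
  [/\ moduli_SL2R B (tauX B p), moduli_SL2R B (untauX B p),
      moduli_SL2R B (tauY B p) & moduli_SL2R B (untauY B p)].
Proof.
move=> Mp; split.
- exact: (moduli_tauX (j := idfun) (fun g H => H) (@SL2R_mul R) (@SL2R_adj R)).
- exact: (moduli_untauX (j := idfun) (fun g H => H) (@SL2R_mul R) (@SL2R_adj R)).
- exact: (moduli_tauY (j := idfun) (fun g H => H) (@SL2R_mul R) (@SL2R_adj R)).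
- exact: (moduli_untauY (j := idfun) (fun g H => H) (@SL2R_mul R) (@SL2R_adj R)).
Qed.

Lemma moduli_SU2_maps p : moduli_SU2 B p ->
  [/\ moduli_SU2 B (tauX B p), moduli_SU2 B (untauX B p),
      moduli_SU2 B (tauY B p) & moduli_SU2 B (untauY B p)].
Proof.
move=> Mp; split.
- exact: (moduli_tauX (j := real_complex R) (@SU2_det R) (@SU2_mul R) (@SU2_adj R)).
- exact: (moduli_untauX (j := real_complex R) (@SU2_det R) (@SU2_mul R) (@SU2_adj R)).
- exact: (moduli_tauY (j := real_complex R) (@SU2_det R) (@SU2_mul R) (@SU2_adj R)).
- exact: (moduli_untauY (j := real_complex R) (@SU2_det R) (@SU2_mul R) (@SU2_adj R)).
Qed.

Lemma MB_maps p : MB B p ->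
  [/\ MB B (tauX B p), MB B (untauX B p), MB B (tauY B p) & MB B (untauY B p)].
Proof.
rewrite /MB; case: asboolP => _; first exact: moduli_SU2_maps.
move=> [Mp cp]; have [M1 M2 M3 M4] := moduli_SL2R_maps Mp.
split; split=> //; [
  apply: (compact_component_homeo (g := untauX B)) |
  apply: (compact_component_homeo (g := tauX B)) |
  apply: (compact_component_homeo (g := untauY B)) |
  apply: (compact_component_homeo (g := tauY B)) ] => //;
  try (by move=> q /moduli_SL2R_maps[]);
  by [exact: tauX_continuous | exact: untauX_continuous
     |exact: tauY_continuous | exact: untauY_continuous
     |exact: tauXK | exact: untauXK | exact: tauYK | exact: untauYK].
Qed.

(** An equivalence, so that the induction passes to inverses. *)
Lemma Gamma_MB f : Gamma B f -> forall p, MB B (f p) <-> MB B p.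
Proof.
elim=> {f} [p|p|//|f g _ IHf _ IHg p|f g _ IHf fK gK p].
- split=> [/MB_maps[_]|/MB_maps[]//]; by rewrite tauXK.
- split=> [/MB_maps[_ _ _]|/MB_maps[]//]; by rewrite tauYK.
- by rewrite /= IHf.
- by rewrite -IHf gK.
Qed.

Lemma Gamma_untauX : Gamma B (untauX B).
Proof. exact: Gamma_inv (Gamma_tauX B) (tauXK B) (untauXK B). Qed.

Lemma Gamma_untauY : Gamma B (untauY B).
Proof. exact: Gamma_inv (Gamma_tauY B) (tauYK B) (untauYK B). Qed.

Lemma orbit_maps f p q : Gamma B f -> Gamma_orbit B p q -> Gamma_orbit B p (f q).
Proof. by move=> Gf [g Gg ->]; exists (f \o g) => //; exact: Gamma_comp. Qed.

(** The first group gives the quartic four distinct roots inside (-2, 2); the other conditions force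
    a nonempty closed invariant set to contain a nondegenerate section. *)
Definition generic_data : Prop := let V := @rational_traces R in
  [/\ [/\ a != b, a != - b, c != d, c != - d &
          forall x, kappa a b x = 0 -> kappa c d x != 0],
      forall x y y' y'', V x -> V y -> V y' -> V y'' ->
        2 * e2 - x * e3 <> 2 * y + y' + y'' - x ^+ 2 * y,
      (forall x, V x -> e1 <> 2 * x) /\ (forall y, V y -> e2 <> 2 * y),
      (forall x y, V x -> V y ->
        let m := 2 - y ^+ 2 in let n := e3 - y * e1 + y * x in
        2 * y * m ^+ 2 + (e1 - x) * m * n - y * n ^+ 2 <> e2 * m ^+ 2) &
      (forall x y, V x -> V y ->
        let m := 2 - x ^+ 2 in let n := e3 - x * e2 + x * y in
        2 * x * m ^+ 2 + (e2 - y) * m * n - x * n ^+ 2 <> e1 * m ^+ 2)].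

Lemma closed_surf_range (l r : R) :
  closed [set p : space | surf e1 e2 e3 h p.1.1 p.1.2 p.2 /\ l <= p.1.1 <= r].
Proof.
pose F (p : space) := p.1.1 ^+ 2 + p.1.2 ^+ 2 + p.2 ^+ 2 + p.1.1 * p.1.2 * p.2
  - (e1 * p.1.1 + e2 * p.1.2 + e3 * p.2 - h).
have cF p : {for p, continuous F} by rewrite /F; cts.
have cx (p : space) : {for p, continuous (fun p : space => p.1.1)} by cts.
rewrite (_ : [set p | _] = F @^-1` [set t | t = 0] `&`
  ((fun p : space => p.1.1) @^-1` [set t | l <= t] `&`
   (fun p : space => p.1.1) @^-1` [set t | t <= r])).
  apply: closedI; first by apply: (continuous_closedP F).1 => //; exact: closed_eq.
  apply: closedI; first by apply: (continuous_closedP _).1 cx _ _; exact: closed_ge.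
  by apply: (continuous_closedP _).1 cx _ _; exact: closed_le.
apply/seteqP; split=> p /=.
  by rewrite /surf /F => -[-> /andP[? ?]]; rewrite subrr.
by rewrite /surf /F => -[/eqP + [-> ->]]; rewrite subr_eq0 => /eqP.
Qed.

Lemma generic_minimal : open_box R B -> generic_data -> minimal_action B.
Proof.
move=> [a2 b2 c2 d2] [[n1 n2 n3 n4 ncr] g1 [g2 g3] g4 g5] p Mp.
have [r1 [r2 [r3 [r4 [rs lr rng]]]]] := MB_range a2 b2 c2 d2 n1 n2 n3 n4 ncr.
have OM q : Gamma_orbit B p q -> MB B q by move=> [g Gg ->]; apply/Gamma_MB.
split=> // q Mq; set C := closure (Gamma_orbit B p).
have CX f : continuous f -> Gamma B f -> forall s, C s -> C (f s).
  by move=> cf Gf s; apply: closure_invariant => // t; exact: orbit_maps.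
have Cr x y z : C (x, y, z) -> surf e1 e2 e3 h x y z /\ r2 <= x <= r3.
  have : C `<=` [set p | surf e1 e2 e3 h p.1.1 p.1.2 p.2 /\ r2 <= p.1.1 <= r3].
    rewrite [X in _ `<=` X]((closure_id _).1 (@closed_surf_range r2 r3)).
    by apply: closureS => -[[x' y'] z'] /OM /rng.
  by move=> H /H.
case: q Mq => -[x y] z /rng[S xr].
apply: (closed_invariant_full rs lr _ Cr _ _ g1 g2 g3 g4 g5 (p := p)) => //.
- exact: closed_closure.
- move=> x' y' z' Cp'; split.
    by have := CX _ tauX_continuous (Gamma_tauX B) _ Cp'.
  by have := CX _ untauX_continuous Gamma_untauX _ Cp'.
(* After the exchange of x and y the inverse twist comes first. *)
- move=> x' y' z' Cp'; split; rewrite /swapxy /= ?[x' * y']mulrC.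
    by have := CX _ untauY_continuous Gamma_untauY _ Cp'.
  by have := CX _ tauY_continuous (Gamma_tauY B) _ Cp'.
- by apply: subset_closure; exists idfun => //; exact: Gamma_id.
Qed.

End GammaAction.

(** * Density of the generic boundary data *)

Section Genericity.
Variable R : realType.
Local Notation V := (@rational_traces R).

Lemma countableU (T : Type) (A B : set T) :
  countable A -> countable B -> countable (A `|` B).
Proof. by move=> cA cB; rewrite -bigcup2E; apply: bigcup_countable => // -[|[|]]. Qed.

Lemma countable_range (T : countType) (f : T -> R) : countable (range f).
Proof. by apply: sub_countable (card_image_le _ _) _; exact: countableP. Qed.

(** The roots are enumerated by the quadratic formula ([f1], [f2]), or by the linear one ([f3])
    where the leading coefficient vanishes. *)
Lemma countable_quadratic (T : countType) (p q r : T -> R) :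
  (forall i, p i != 0 \/ q i != 0) ->
  countable [set t | exists i, p i * t ^+ 2 + q i * t + r i = 0].
Proof.
move=> pq0.
pose f1 i := (Num.sqrt (q i ^+ 2 - 4 * p i * r i) - q i) / (2 * p i).
pose f2 i := (- Num.sqrt (q i ^+ 2 - 4 * p i * r i) - q i) / (2 * p i).
pose f3 i := - r i / q i.
apply: (@sub_countable _ _ _ (range f1 `|` range f2 `|` range f3)); last first.
  by do 2?apply: countableU; exact: countable_range.
apply: subset_card_le => t [i E].
have [p0|p0] := eqVneq (p i) 0.
  have [|q0] := pq0 i; first by rewrite p0 eqxx.
  right; exists i => //; rewrite /f3; apply: (mulIf q0); rewrite divfK //.
  by rewrite p0 mul0r add0r in E; lra.
left; have D : (2 * p i * t + q i) ^+ 2 = q i ^+ 2 - 4 * p i * r i.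
  have -> : r i = - (p i * t ^+ 2 + q i * t) by lra.
  by ring.
have p2 : 2 * p i != 0 by rewrite mulf_neq0 // pnatr_eq0.
have [s0|s0] := leP 0 (2 * p i * t + q i).
  left; exists i => //; rewrite /f1 -D sqrtr_sqr ger0_norm //.
  by apply: (mulIf p2); rewrite divfK //; ring.
right; exists i => //; rewrite /f2 -D sqrtr_sqr ltr0_norm //.
by apply: (mulIf p2); rewrite divfK //; ring.
Qed.

Definition rational_trace (i : nat * nat) : R :=
  2 * cos (pi * i.1%:R / i.2.+1%:R).

Lemma rational_traceP x : V x -> exists i, x = rational_trace i.
Proof. by move=> [m [n ->]]; exists (m, n). Qed.

Local Notation v := rational_trace.

(* For fixed a, b and c each genericity condition says that d is not a root of
   one of countably many polynomials of degree at most 2; the choice of b and c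
   makes all of them nonzero. *)
Lemma exists_generic (la ra lb rb lc rc ld rd : R) :
  la < ra -> lb < rb -> lc < rc -> ld < rd ->
  exists a b c d, [/\ [/\ la < a < ra, lb < b < rb, lc < c < rc & ld < d < rd] &
    generic_data a b c d].
Proof.
move=> la_ra lb_rb lc_rc ld_rd.
have [a ar /eqP a0] := countable_avoid (countable1 (0 : R)) la_ra.
(* Values of [b] at which [b - v i * a] or [2 * a - v i * b] could vanish. For [v i = 0] the second
   is [2 * a], nonzero without any exclusion. *)
pose Sb := range (fun i => v i * a) `|` range (fun i => 2 * a / v i) `|`
  [set 0; a; - a].
have cSb : countable Sb.
  by do ?apply: countableU; by [exact: countable_range|exact: countable1].
have [b br nSb] := countable_avoid cSb lb_rb.
have b0 : b != 0 by apply/eqP => E; apply: nSb; right; left; left.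
have ba : a != b by apply/eqP => E; apply: nSb; right; left; right.
have bNa : a != - b.
  by apply/eqP => E; apply: nSb; right; right; rewrite /= E opprK.
have bxa i : b - v i * a != 0.
  by rewrite subr_eq0; apply/eqP => E; apply: nSb; left; left; exists i.
have axb i : 2 * a - v i * b != 0.
  rewrite subr_eq0; apply/eqP => E; apply: nSb; left; right; exists i => //.
  have [v0|v0] := eqVneq (v i) 0.
    by move/eqP: E; rewrite v0 mul0r mulf_eq0 pnatr_eq0 (negPf a0).
  by rewrite E mulrC mulKf.
(* Likewise for [b - v i * c] and [2 * c - v i * b]. *)
pose Sc := range (fun i => b / v i) `|` range (fun i => v i * b / 2) `|` [set 0].
have cSc : countable Sc.
  by do ?apply: countableU; by [exact: countable_range|exact: countable1].
have [c cr nSc] := countable_avoid cSc lc_rc.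
have c0 : c != 0 by apply/eqP => E; apply: nSc; right.
have bxc i : b - v i * c != 0.
  rewrite subr_eq0; apply/eqP => E; apply: nSc; left; left; exists i => //.
  have [v0|v0] := eqVneq (v i) 0.
    by move/eqP: E; rewrite v0 mul0r (negPf b0).
  by rewrite E mulrC mulKf.
have cxb i : 2 * c - v i * b != 0.
  rewrite subr_eq0; apply/eqP => E; apply: nSc; left; right; exists i => //.
  by rewrite -E mulrC mulKf ?pnatr_eq0.
pose I4 := ((nat * nat) * (nat * nat) * (nat * nat) * (nat * nat))%type.
pose S1 := [set d | exists i : I4, let x := v i.1.1.1 in let y := v i.1.1.2 in
  0 * d ^+ 2 + (2 * a - x * b) * d + (2 * b * c - x * a * c
    - (2 * y + v i.1.2 + v i.2 - x ^+ 2 * y)) = 0].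
pose S2 := [set d | exists i, 0 * d ^+ 2 + c * d + (a * b - 2 * v i) = 0].
pose S3 := [set d | exists i, 0 * d ^+ 2 + a * d + (b * c - 2 * v i) = 0].
(* [kappa c d x] as a polynomial in [d], at the two roots of [kappa a b]. *)
pose S6 := [set d | exists i : bool, let x := if i then Iplus a b else Iminus a b in
  1 * d ^+ 2 + (- (c * x)) * d + (x ^+ 2 + c ^+ 2 - 4) = 0].
(* Here [n = n0 + n1 * d], and the leading coefficient [c * m * n1 - y * n1 ^+ 2] equals
   [n1 * (2 * c - y * b)], a product of factors made nonzero above. *)
pose S4 := [set d | exists i : (nat * nat) * (nat * nat),
  let x := v i.1 in let y := v i.2 in
  let m := 2 - y ^+ 2 in let n0 := a * c - y * a * b + y * x in
  let n1 := b - y * c in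
  (n1 * (2 * c - y * b)) * d ^+ 2
  + (c * m * n0 + (a * b - x) * m * n1 - 2 * y * n0 * n1 - a * m ^+ 2) * d
  + (2 * y * m ^+ 2 + (a * b - x) * m * n0 - y * n0 ^+ 2 - b * c * m ^+ 2) = 0].
pose S5 := [set d | exists i : (nat * nat) * (nat * nat),
  let x := v i.1 in let y := v i.2 in
  let m := 2 - x ^+ 2 in let n0 := a * c - x * b * c + x * y in
  let n1 := b - x * a in
  (n1 * (2 * a - x * b)) * d ^+ 2
  + (a * m * n0 + (b * c - y) * m * n1 - 2 * x * n0 * n1 - c * m ^+ 2) * d
  + (2 * x * m ^+ 2 + (b * c - y) * m * n0 - x * n0 ^+ 2 - a * b * m ^+ 2) = 0].
pose Sd := S1 `|` S2 `|` S3 `|` S4 `|` S5 `|` S6 `|` [set c; - c].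
have cSd : countable Sd.
  do ?apply: countableU; try exact: countable1.
  - by apply: countable_quadratic => i; right.
  - by apply: countable_quadratic => i; right.
  - by apply: countable_quadratic => i; right.
  - by apply: countable_quadratic => i; left; rewrite mulf_neq0.
  - by apply: countable_quadratic => i; left; rewrite mulf_neq0.
  - by apply: countable_quadratic => i; left; rewrite oner_eq0.
have [d dr nSd] := countable_avoid cSd ld_rd.
exists a, b, c, d; split=> //; split.
- split=> //.
  + by apply/eqP => E; apply: nSd; right; left.
  + by apply/eqP => E; apply: nSd; right; right; rewrite /= E opprK.
  + move=> x kx; apply/eqP => kx'; apply: nSd; left; right.
    have sq : (2 * x - a * b) ^+ 2 = (a ^+ 2 - 4) * (b ^+ 2 - 4).
      by move: kx; rewrite /kappa => kx; lra.
    have [s0|s0] := leP 0 (2 * x - a * b).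
      exists true; rewrite /= /Iplus -sq sqrtr_sqr ger0_norm //.
      by rewrite (_ : (_ + _) / 2 = x) //; [move: kx'; rewrite /kappa => kx'; lra|field].
    exists false; rewrite /= /Iminus -sq sqrtr_sqr ltr0_norm //.
    by rewrite (_ : (_ - _) / 2 = x) //; [move: kx'; rewrite /kappa => kx'; lra|field].
- move=> x y y' y'' /rational_traceP[i1 ->] /rational_traceP[i2 ->].
  move=> /rational_traceP[i3 ->] /rational_traceP[i4 ->] E; apply: nSd.
  do 6 left; exists (i1, i2, i3, i4) => /=; lra.
- split=> [x /rational_traceP[i ->] E|y /rational_traceP[i ->] E]; apply: nSd.
    by do 5 left; right; exists i; lra.
  by do 4 left; right; exists i; lra.
- move=> x y /rational_traceP[i1 ->] /rational_traceP[i2 ->] /= E; apply: nSd.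
  do 3 left; right; exists (i1, i2) => /=.
  by apply/eqP; move/eqP: E; rewrite -subr_eq0; congr (_ == 0); ring.
- move=> x y /rational_traceP[i1 ->] /rational_traceP[i2 ->] /= E; apply: nSd.
  do 2 left; right; exists (i1, i2) => /=.
  by apply/eqP; move/eqP: E; rewrite -subr_eq0; congr (_ == 0); ring.
Qed.

End Genericity.

Theorem corollary1p3 (R : realType) :
  exists D : set (R * R * R * R),
    [/\ D `<=` open_box R,
        dense_in (closed_box R) D &
        forall B : R * R * R * R, D B -> minimal_action B].
Proof.
exists [set B | open_box R B /\
  let: (a, b, c, d) := B in generic_data a b c d]; split.
- by move=> B [].
- split=> [[[[a b] c] d] [[/andP[? ?] /andP[? ?] /andP[? ?] /andP[? ?]] _]|].
    by split; rewrite !ltW.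
  move=> [[[a0 b0] c0] d0] [/andP[a1 a2] /andP[b1 b2] /andP[c1 c2] /andP[d1 d2]].
  move=> U /nbhs_ballP[e /= e0 eU].
  (* The part of the neighbourhood inside (-2, 2) is nonempty even when [t] is an end of the closed
     interval. *)
  have near (t : R) : -2 <= t -> t <= 2 ->
      Num.max (-2) (t - e) < Num.min 2 (t + e).
    by move=> ? ?; rewrite lt_min !gt_max; lra.
  have [a [b [c [d [[]]]]]] := exists_generic (near a0 a1 a2) (near b0 b1 b2)
    (near c0 c1 c2) (near d0 d1 d2).
  rewrite !lt_min !gt_max => /andP[/andP[a3 a4] /andP[a5 a6]].
  move=> /andP[/andP[b3 b4] /andP[b5 b6]] /andP[/andP[c3 c4] /andP[c5 c6]].
  move=> /andP[/andP[d3 d4] /andP[d5 d6]] gen.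
  exists (a, b, c, d); split.
    by split=> //; split; apply/andP; split.
  have close (s t : R) : t - e < s -> s < t + e -> ball t e s.
    by move=> ? ?; rewrite /ball /= ltr_norml; lra.
  by apply: eU; split; [split; [split|]|]; exact: close.
- by move=> [[[a b] c] d] [Bo gen]; exact: generic_minimal.
Qed.
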